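(* Assume (A1)–(A3) with functions $\xi_1,\xi_2$, and let $x_0>1$ with $\Phi(x_0)<\infty$. Then each $X_n$ is a normal integrand w.r.t. $\Theta\times\mathbb R$ and $(\Omega,\mathcal F)$, and $S_n(\omega)\ne\emptyset$ for all $n\in\mathbb N$, $\omega\in\Omega$. Moreover $S_n(\omega)\subseteq\Theta\times[x_l,x_u]$ for all $n\in\mathbb N$ and $\omega\in A_n$, where $x_l:=-\Phi(0)-1-\mathbb E[\xi_2(Z_1)]$, $x_u:=\frac{\Phi(x_0)+1+x_0+\mathbb E[\xi_2(Z_1)]+x_0\mathbb E[\xi_1(Z_1)]}{x_0-1}$, and $A_n:=\{\omega:\max_{j=1,2}|\frac1n\sum_{i=1}^n\xi_j(Z_i(\omega))-\mathbb E[\xi_j(Z_1)]|\le1\}$. In particular there is $A\in\mathcal F$ with $\mathbb P(A)=1$ such that for each $\omega\in A$ there is $n(\omega)\in\mathbb N$ with $S_n(\omega)\subseteq\Theta\times[x_l,x_u]$ for all $n\ge n(\omega)$.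
   Context: $(\Omega,\mathcal F,\mathbb P)$ probability space; $\Theta\subseteq\mathbb R^m$ nonempty compact; $Z_1,Z_2,\dots$ i.i.d. $\mathbb R^d$-valued random vectors with law $\mathbb P^Z$; $G:\Theta\times\mathbb R^d\to\mathbb R$; $\Phi:[0,\infty[\to[0,\infty]$ lower semicontinuous convex, $\Phi(0)<\infty$, $\Phi(x_0)<\infty$ for some $x_0>1$, $\inf\Phi=0$, $\Phi(x)/x\to\infty$; $\Phi^*(y)=\sup_{x\ge0}(xy-\Phi(x))$; $H^{\Phi^*}=\{X:\mathbb E[\Phi^*(c|X|)]<\infty\ \forall c>0\}$. $X_n(\omega,\theta,x):=\frac1n\sum_{i=1}^n(\Phi^*(G(\theta,Z_i(\omega))+x)-x)$; $S_n(\omega):=\{(\theta,x)\in\Theta\times\mathbb R: X_n(\omega,\theta,x)=\inf_{\Theta\times\mathbb R}X_n(\omega,\cdot,\cdot)\}$. (A1) $G$ is $\mathcal B(\Theta)\otimes\mathcal B(\mathbb R^d)$-measurable and $G(\cdot,z)$ lower semicontinuous. (A2) $\sup_\theta|G(\theta,z)|\le\xi_1(z)$, $\xi_1$ $\mathbb P^Z$-integrable. (A3) $G(\theta,Z_1)\in H^{\Phi^*}$ for all $\theta$ and $\sup_\theta|\Phi^*(G(\theta,z))|\le\xi_2(z)$, $\xi_2$ $\mathbb P^Z$-integrable. Normal integrand w.r.t. $\mathcal X$ and $(\bar\Omega,\bar{\mathcal F})$: $\bar f:\bar\Omega\times\mathcal X\to\mathbb R$ with $\bar f(\bar\omega,\cdot)$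 lower semicontinuous for all $\bar\omega$ and $\{\bar\omega:\operatorname{epi}\bar f(\bar\omega,\cdot)\cap U\ne\emptyset\}\in\bar{\mathcal F}$ for every open $U\subseteq\mathcal X\times\mathbb R$. *)

(* Defs.v *)
From HB Require Import structures.
From mathcomp Require Import all_boot all_order all_algebra.
From mathcomp Require Import all_classical all_reals all_analysis.
Set Implicit Arguments. Unset Strict Implicit. Unset Printing Implicit Defensive.
Import Order.TTheory GRing.Theory Num.Theory.
Import numFieldNormedType.Exports.
Local Open Scope classical_set_scope.
Local Open Scope ring_scope.

Definition Borel (R : realType) (n : nat) := g_sigma_algebraType (@open 'rV[R]_n).

(** Convex conjugate Phi^*(y) = sup_{x >= 0} (x y - Phi(x)) of
    Phi : [0, oo[ -> [0, +oo] (Phi is given as a map R -> \bar R whose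
    values on negative reals are irrelevant). *)
Definition conj_fun (R : realType) (Phi : R -> \bar R) (y : R) : \bar R :=
  ereal_sup [set ((x * y)%:E - Phi x)%E | x in [set x : R | 0 <= x]].

Definition convex_on_nonneg (R : realType) (Phi : R -> \bar R) :=
  forall x y l : R, 0 <= x -> 0 <= y -> 0 <= l -> l <= 1 ->
    (Phi (l * x + (1 - l) * y)%R <= l%:E * Phi x + (1 - l)%:E * Phi y)%E.

Definition lsc_on_nonneg (R : realType) (Phi : R -> \bar R) :=
  @lower_semicontinuous (subspace [set x : R | 0 <= x]) R Phi.

Definition mutually_independent d d' (Omega : measurableType d)
  (T : measurableType d') (R : realType) (P : probability Omega R)
  (Z : nat -> Omega -> T) :=
  forall (s : seq nat) (B : nat -> set T), uniq s ->
    (forall i, measurable (B i)) ->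
    P (\big[setI/setT]_(i <- s) (Z i @^-1` B i)) =
    (\prod_(i <- s) P (Z i @^-1` B i))%E.

Definition identically_distributed d d' (Omega : measurableType d)
  (T : measurableType d') (R : realType) (P : probability Omega R)
  (Z : nat -> Omega -> T) :=
  forall i (B : set T), measurable B -> P (Z i @^-1` B) = P (Z 0 @^-1` B).

Definition open_in (T : topologicalType) (D U : set T) :=
  U `<=` D /\ exists V : set T, open V /\ U = V `&` D.

Definition epi_on (T : Type) (R : realType) (D : set T) (f : T -> R) :
  set (T * R) := [set p | D p.1 /\ f p.1 <= p.2].

Definition normal_integrand d (Omega : measurableType d) (T : topologicalType)
  (R : realType) (D : set T) (f : Omega -> T -> R) :=
  (forall w, @lower_semicontinuous (subspace D) R (fun x => (f w x)%:E)) /\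
  (forall U : set (T * R), open_in (D `*` setT) U ->
     measurable [set w | epi_on D (f w) `&` U !=set0]).

(** X_n(w, theta, x) = 1/n sum_{i=1}^n (Phi^*(G(theta, Z_i(w)) + x) - x);
    the sample is Z 0, ..., Z (n-1) (i.e. Z_i of the paper is Z (i-1)). *)
Definition Xn (R : realType) (Omega : Type) (m d : nat) (Phi : R -> \bar R)
  (G : 'rV[R]_m -> 'rV[R]_d -> R) (Z : nat -> Omega -> 'rV[R]_d) (n : nat)
  (w : Omega) (p : 'rV[R]_m * R) : R :=
  n%:R^-1 * \sum_(i < n) (fine (conj_fun Phi (G p.1 (Z i w) + p.2)) - p.2).

Definition Sn (R : realType) (Omega : Type) (m d : nat) (Phi : R -> \bar R)
  (Theta : set 'rV[R]_m)
  (G : 'rV[R]_m -> 'rV[R]_d -> R) (Z : nat -> Omega -> 'rV[R]_d) (n : nat)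
  (w : Omega) : set ('rV[R]_m * R) :=
  [set p | (Theta `*` setT) p /\
     ((Xn Phi G Z n w p)%:E =
      ereal_inf [set (Xn Phi G Z n w q)%:E | q in Theta `*` setT])%E].

(* Main.v *)
Require Import Defs.
From HB Require Import structures.
From mathcomp Require Import all_boot all_order all_algebra.
From mathcomp Require Import all_classical all_reals all_analysis.
From mathcomp Require Import measurable_realfun ring lra.
Import Order.TTheory GRing.Theory Num.Theory.
Import numFieldNormedType.Exports.
Local Open Scope classical_set_scope.
Local Open Scope ring_scope.

(** The empirical objective is a normal integrand because, for rational x and t,
    the event that it is at most t at (theta, x) for some theta in a compact
    subset of [Theta] is the preimage, under the sample, of the projection of a
    Borel set with compact sections.  Omega need not be complete, so analytic
    measurability does not suffice: Novikov's separation argument shows that such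
    a projection is Borel.

    Since [Phi^*(y)] is at least [- Phi 0] and [x0 * y - Phi x0], the objective is
    bounded below by lines in x of slopes -1 and x0 - 1 > 0, whereas at x = 0 it
    is at most the sample mean of [xi2]: this gives existence and localization of
    the minimizers.  Only upper bounds on the sample means of [xi1] and [xi2] are
    used, so a one-sided strong law suffices.  It follows by truncation, Chebyshev's
    inequality and Borel-Cantelli along the sample sizes c * 2 ^ j, and by
    monotonicity of the partial sums in between. *)

(** * Suslin sets and projections of Borel sets with compact sections *)

Lemma compact_nested {T : ptopologicalType} (K : set T) (F : nat -> set T) :
  compact K -> (forall k, closed (F k)) ->
  (forall j k, (j <= k)%N -> F k `<=` F j) ->
  (forall k, K `&` F k !=set0) -> exists x, K x /\ forall k, F k x.
Proof.
rewrite compact_cover => cK cF dF ne; apply: contrapT => nex.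
have [||D' _ cov] := cK _ [set: nat] (fun k => ~` F k).
- by move=> k _; exact/closed_openC.
- move=> x Kx; apply: contrapT => nc; apply: nex; exists x; split => // k.
  by apply: contrapT => nF; apply: nc; exists k.
have [x [Kx Fx]] := ne (\max_(k <- finmap.enum_fset D') k)%N.
have [k kD nF] := cov _ Kx; apply: nF; apply: dF Fx.
exact: (@leq_bigmax_seq _ (finmap.enum_fset D') xpredT id k kD).
Qed.

Definition suslin {T : topologicalType} (A : set T) :=
  exists2 C : seq nat -> set T, (forall s, closed (C s)) &
    A = [set x | exists f : nat -> nat, forall k, C (mkseq f k) x].

Lemma mkseqSr {T : Type} (f : nat -> T) n :
  mkseq f n.+1 = f 0%N :: mkseq (f \o S) n.
Proof. by rewrite /mkseq (map_comp f S); congr (_ :: map f _); exact: (iotaDl 1 0). Qed.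

Section suslin.
Context {T : topologicalType}.
Implicit Types A : set T.

Lemma closed_suslin A : closed A -> suslin A.
Proof.
move=> cA; exists (fun=> A) => //; apply/seteqP; split => [x Ax|x [f /(_ 0%N)]//].
by exists (fun=> 0%N).
Qed.

(** The first entry of a branch selects a member of the union; the remaining entries form a branch
    of the scheme of that member. *)
Lemma suslin_bigcup (A : nat -> set T) :
  (forall i, suslin (A i)) -> suslin (\bigcup_i A i).
Proof.
move=> sA; have /all_sig2[C cC AE] := fun i => cid2 (sA i).
exists (fun s => if s is i :: s' then C i s' else setT).
  by case=> [|i s]; [exact: closedT|exact: cC].
apply/seteqP; split => [x [i _]|x [f fx]].
  rewrite AE => -[f fx]; exists (fun k => if k is k'.+1 then f k' else i).
  by case=> [//|k]; rewrite (mkseqSr _ k).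
exists (f 0%N) => //; rewrite AE; exists (f \o S) => k.
rewrite -[mkseq _ _]/(behead (f 0%N :: _)) -mkseqSr; exact: (fx k.+1).
Qed.

(** One branch codes countably many: its entry at [c i j] is the [j]-th entry of a branch for [A i].
    The closed set at [s] imposes exactly those conditions whose entries have all been read in
    [s]. *)
Lemma suslin_bigcap (A : nat -> set T) :
  (forall i, suslin (A i)) -> suslin (\bigcap_i A i).
Proof.
move=> sA; have /all_sig2[C cC AE] := fun i => cid2 (sA i).
pose c (i j : nat) := pickle (i, j).
exists (fun s => \bigcap_(p in [set p : nat * nat |
    forall j, (j < p.2)%N -> (c p.1 j < size s)%N])
    C p.1 (mkseq (fun j => nth 0%N s (c p.1 j)) p.2)).
  by move=> s; apply: closed_bigI => p _; exact: cC.
apply/seteqP; split => [x Ax|x [f fx] i _].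
  have /choice[F Fx] i : exists f, forall k, C i (mkseq f k) x.
    by have := Ax i I; rewrite AE.
  exists (fun l => if unpickle l is Some p then F p.1 p.2 else 0%N) => k.
  move=> [i n] /= lt; have := Fx i n; congr (C i _ x).
  apply/eq_in_map => j; rewrite mem_iota add0n => /andP[_ jn].
  by rewrite nth_mkseq /c /= ?pickleK//; have := lt _ jn; rewrite size_mkseq.
rewrite AE; exists (fun j => f (c i j)) => k.
(* A prefix of length [N] contains the first [k] entries of the [i]-th coded branch. *)
pose N := (\max_(j < k) (c i j).+1)%N.
have cN j : (j < k)%N -> (c i j < N)%N.
  by move=> jk; exact: (@leq_bigmax _ (fun j : 'I_k => (c i j).+1) (Ordinal jk)).
have := fx N (i, k); rewrite /= => /(_ _).
have -> : mkseq (fun j => nth 0%N (mkseq f N) (c i j)) k =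
   mkseq (fun j => f (c i j)) k.
  apply/eq_in_map => j; rewrite mem_iota add0n => /andP[_ jn].
  by rewrite nth_mkseq// cN.
by apply => j jk; rewrite size_mkseq cN.
Qed.

(** This class is a sigma-algebra containing the open sets when there is a countable regular base.
    The separation argument needs schemes for a Borel set and for its complement. *)
Definition bisuslin A := suslin A /\ suslin (~` A).

Lemma bisuslinC A : bisuslin A -> bisuslin (~` A).
Proof. by move=> [a b]; split; rewrite ?setCK. Qed.

Lemma bisuslin_bigcup (A : nat -> set T) :
  (forall i, bisuslin (A i)) -> bisuslin (\bigcup_i A i).
Proof.
move=> bA; split; first by apply: suslin_bigcup => i; case: (bA i).
by rewrite setC_bigcup; apply: suslin_bigcap => i; case: (bA i).
Qed.

Lemma bisuslin0 : bisuslin set0.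
Proof.
by split; apply: closed_suslin; rewrite ?setC0; [exact: closed0|exact: closedT].
Qed.

Lemma sigma_algebra_bisuslin : sigma_algebra setT bisuslin.
Proof.
split; [exact: bisuslin0| |exact: bisuslin_bigcup].
by move=> A bA; rewrite setTD; exact: bisuslinC.
Qed.

End suslin.

Lemma suslin_preimage {T U : topologicalType} (f : T -> U) (A : set U) :
  continuous f -> suslin A -> suslin (f @^-1` A).
Proof.
move=> cf [C cC ->]; exists (fun s => f @^-1` C s) => //.
by move=> s; apply: preimage_closed => // x _; exact: cf.
Qed.

(** The closure makes every open set a countable union of closed sets, and later yields compact
    neighbourhoods inside a compact set. *)
Definition regular_base {T : topologicalType} (W : nat -> set T) :=
  (forall n, open (W n)) /\
  forall x (O : set T), nbhs x O -> exists2 n, W n x & closure (W n) `<=` O.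

Lemma open_suslin {T : topologicalType} (W : nat -> set T) (U : set T) :
  regular_base W -> open U -> suslin U.
Proof.
move=> [_ bW] oU.
pose F n := if pselect (closure (W n) `<=` U) then closure (W n) else set0.
have -> : U = \bigcup_n F n.
  apply/seteqP; split => [x Ux|x [n _]]; last first.
    by rewrite /F; case: pselect => // sub; exact: sub.
  have [n Wx cW] := bW _ _ (open_nbhs_nbhs (conj oU Ux)).
  exists n => //; rewrite /F.
  by case: (pselect (closure (W n) `<=` U)) => [?|/(_ cW)//]; exact: subset_closure.
apply: suslin_bigcup => n; apply: closed_suslin; rewrite /F.
by case: (pselect (closure (W n) `<=` U)) => ?; [exact: closed_closure|exact: closed0].
Qed.

Lemma borel_bisuslin {T : topologicalType} (W : nat -> set T) :
  regular_base W -> <<s @open T>> `<=` bisuslin.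
Proof.
move=> bW; apply: smallest_sub; first exact: sigma_algebra_bisuslin.
move=> U oU; split; first exact: open_suslin bW oU.
by apply: closed_suslin; exact: open_closedC.
Qed.

Lemma bisuslin_preimage {T U : topologicalType} (f : T -> U) (A : set U) :
  continuous f -> bisuslin A -> bisuslin (f @^-1` A).
Proof.
by move=> cf [sA sA']; split; [|rewrite preimage_setC]; exact: suslin_preimage.
Qed.

(** The product sigma-algebra is generated by preimages of Borel sets under the two projections,
    which are continuous. *)
Lemma measurable_bisuslin {X Y : ptopologicalType} (WX : nat -> set X)
    (WY : nat -> set Y)
    (A : set (g_sigma_algebraType (@open X) * g_sigma_algebraType (@open Y))) :
  regular_base WX -> regular_base WY -> measurable A ->
  @bisuslin (X * Y)%type A.
Proof.
move=> bX bY; move: A; apply: smallest_sub.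
  exact: sigma_algebra_bisuslin.
move=> _ [|] [B mB <-]; rewrite setTI; apply: bisuslin_preimage.
- by move=> x; exact: cvg_fst.
- exact: (borel_bisuslin _ bX).
- by move=> x; exact: cvg_snd.
- exact: (borel_bisuslin _ bY).
Qed.

HB.instance Definition _ (X Y : ptopologicalType) := Pointed.on (X * Y)%type.

(** * Novikov separation for sets with compact sections *)

Section novikov.
Context {X Y : ptopologicalType}.
Variables (W : nat -> set Y) (KX : set X) (KY : set Y).
Variables CE CN : seq nat -> set (X * Y).
Hypotheses (hX : hausdorff_space X) (bW : regular_base W).
Hypotheses (cKX : compact KX) (cKY : compact KY).
Hypotheses (clE : forall s, closed (CE s)) (clN : forall s, closed (CN s)).
Let E := [set p | exists f : nat -> nat, forall k, CE (mkseq f k) p].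
Hypothesis EC : ~` E = [set p | exists f : nat -> nat, forall k, CN (mkseq f k) p].
Hypothesis sE : forall x, KX x -> closed [set y | KY y /\ E (x, y)].

Let c (i j : nat) : nat := choice.pickle (i, j).
Let scheme (i : nat) := if i is 0%N then CN else CE.

(* One sequence of integers codes countably many branches at once: its value at
   c i j is the j-th entry of the i-th branch.  Branch 0 runs through the
   complement of E, branch n.+1 through the part of E above closure (W n). *)
Let piece (i : nat) (s : seq nat) : set (X * Y) :=
  [set p | exists f : nat -> nat,
     (forall j, (c i j < size s)%N -> f j = nth 0%N s (c i j)) /\
     forall k, scheme i (mkseq f k) p].

(** Separation of the pieces that follow [s] by rectangles [C n] times [W n]. At [[::]] the pieces
    are the complement of [E] and [E] itself, so there the rectangles cover the complement and avoid
    [E]. *)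
Let good (s : seq nat) := exists C : nat -> set (g_sigma_algebraType (@open X)),
  [/\ forall n, measurable (C n),
      forall n x y, KX x -> C n x -> KY y -> closure (W n) y ->
        ~ piece n.+1 s (x, y) &
      forall x y, KX x -> KY y -> piece 0%N s (x, y) ->
        exists2 n, C n x & W n y].

(** The position [size s] codes an entry of at most one branch, so appending an entry can restrict
    only that piece. *)
Let piece_step s : exists i0,
  (forall p, piece i0 s p -> exists m, piece i0 (rcons s m) p) /\
  (forall i, i <> i0 -> forall m, piece i s `<=` piece i (rcons s m)).
Proof.
have keep i m : (forall j, c i j <> size s) -> piece i s `<=` piece i (rcons s m).
  move=> ne p [f [fs fp]]; exists f; split => // j.
  rewrite size_rcons ltnS leq_eqVlt => /predU1P[/ne//|lt].
  by rewrite nth_rcons lt fs.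
exists (if choice.unpickle (size s) is Some q then (q : nat * nat).1 else 0%N).
split=> [p|i ne m]; last first.
  by apply: keep => j cs; apply: ne; rewrite -cs /c choice.pickleK.
move=> [f [fs fp]].
set i := (X in piece X) in fs fp *.
have [[j ij]|nj] := pselect (exists j, c i j = size s).
  exists (f j), f; split => // j'.
  rewrite size_rcons ltnS leq_eqVlt nth_rcons => /predU1P[e|lt]; last first.
    by rewrite lt fs.
  rewrite e ltnn eqxx; congr f; move: e; rewrite -ij /c.
  by move=> /(pcan_inj choice.pickleK) [].
exists 0%N; apply: keep; last by exists f.
by move=> j ij; apply: nj; exists j.
Qed.

(** The piece split by the new entry is the union of its parts. If it is the one to be covered,
    unions over [m] work; if it is the one to be avoided at index [n0], the sets at [n0] are
    intersected and all others united. *)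
Let good_step s : (forall m, good (rcons s m)) -> good s.
Proof.
move=> /choice[C gC]; have [i0 [i0s is0]] := piece_step s.
case: i0 i0s is0 => [|n0] i0s is0.
  exists (fun n => \bigcup_m C m n); split.
  - by move=> n; apply: bigcup_measurable => m _; have [+ _ _] := gC m; exact.
  - move=> n x y Kx [m _ Cx] Ky Wy /(is0 n.+1 (@O_S _ \o esym) m).
    by have [_ + _] := gC m; exact.
  - move=> x y Kx Ky /i0s[m pm]; have [_ _ /(_ x y)] := gC m.
    by case=> // n Cx Wy; exists n => //; exists m.
exists (fun n => if n == n0 then \bigcap_m C m n else \bigcup_m C m n); split.
- move=> n; case: ifP => _.
    by apply: bigcapT_measurable => m; have [+ _ _] := gC m; exact.
  by apply: bigcup_measurable => m _; have [+ _ _] := gC m; exact.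
- move=> n x y Kx; case: eqP => [->|nn0] Cx Ky Wy.
    move=> /i0s[m]; have [_ + _] := gC m; apply => //; exact: Cx.
  case: Cx => m _ Cx /(is0 n.+1 (fun e => nn0 (succn_inj e)) m).
  by have [_ + _] := gC m; exact.
- move=> x y Kx Ky /(is0 0%N (@O_S _)) px.
  (* If the rectangle at [n0] misses the point for some [m], then for this [m] the point is covered
     at another index, where unions were taken. *)
  have [all|/existsNP[m nm]] :=
      pselect (forall m, C m n0 x /\ W n0 y).
    exists n0; last by have [] := all 0%N.
    by rewrite eqxx => m _; have [] := all m.
  have [_ _ /(_ x y Kx Ky (px m))[n Cx Wy]] := gC m.
  exists n => //; case: eqP => [nn0|_]; last by exists m.
  by case: nm; rewrite -nn0.
Qed.

(** A finite-stage approximation to the projection of one branch of [E] above the closure of [W n].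
    It depends on finitely many entries of [h] and is closed, being the projection of a compact
    set. *)
Let hits (h : nat -> nat) (n l : nat) : set X :=
  fst @` ((KX `*` (KY `&` closure (W n))) `&`
    [set p | forall j, (j <= l)%N -> CE (mkseq (fun j => h (c n.+1 j)) j) p]).

Let hits_closed h n l : closed (hits h n l).
Proof.
apply: compact_closed => //; apply: continuous_compact.
  by apply: continuous_subspaceT => x; exact: cvg_fst.
apply: compact_closedI.
  apply: compact_setX => //; apply: compact_closedI => //.
  exact: closed_closure.
have -> : [set p | forall j, (j <= l)%N -> CE (mkseq (fun j => h (c n.+1 j)) j) p]
   = \bigcap_(j in [set j | (j <= l)%N]) CE (mkseq (fun j => h (c n.+1 j)) j).
  by apply/seteqP; split.
by apply: closed_bigI.
Qed.

(** If branch 0 never excludes the point, it lies outside [E]. The section of [E] being closed, some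
    [W n] around [y] has closure missing it. Were [x] in [hits h n l] for all [l], compactness would
    produce a point of the section in that closure. *)
Let branch_cover h x y : KX x -> KY y ->
  (exists k, ~ CN (mkseq (fun j => h (c 0 j)) k) (x, y)) \/
  exists n l, ~ hits h n l x /\ W n y.
Proof.
move=> Kx Ky; have [NN|/existsNP[k nk]] :=
  pselect (forall k, CN (mkseq (fun j => h (c 0%N j)) k) (x, y)); last first.
  by left; exists k.
right; have nE : (~` E) (x, y) by rewrite EC; exists (fun j => h (c 0%N j)).
have nb : nbhs y (~` [set y | KY y /\ E (x, y)]).
  apply: open_nbhs_nbhs; split; first exact/closed_openC/sE.
  by move=> [].
have [n Wy cWn] := bW.2 _ _ nb; exists n.
apply: contrapT => nl.
have hl l : hits h n l x.
  by apply: contrapT => nh; apply: nl; exists l.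
have [||||z [[Kz Wz] Ez]] := @compact_nested Y (KY `&` closure (W n))
    (fun l => [set y | forall j, (j <= l)%N ->
       CE (mkseq (fun j => h (c n.+1 j)) j) (x, y)]).
- by apply: compact_closedI => //; exact: closed_closure.
- move=> l; rewrite (_ : mkset _ = \bigcap_(j in [set j | (j <= l)%N])
    (pair x @^-1` CE (mkseq (fun j => h (c n.+1 j)) j))); last first.
    by apply/seteqP; split.
  apply: closed_bigI => j _; apply: preimage_closed => // y' _.
  by apply: cvg_pair; [exact: cvg_cst|exact: cvg_id].
- by move=> j k jk z Hz i ij; apply: Hz; exact: leq_trans ij jk.
- move=> l; have [[x' y'] [[/= _ [Ky' Wy'] Hl]] <-] := hl l.
  by exists y'; split.
apply: (cWn z Wz); split => //; exists (fun j => h (c n.+1 j)) => k.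
exact: (Ez k k).
Qed.

(** By compactness finitely many of the open sets from [branch_cover] suffice, and together they
    depend on a finite prefix of [h]. *)
Let branch_good h : exists N, good (mkseq h N).
Proof.
pose f (q : nat * nat + nat) : set (X * Y) := match q with
  | inl (n, l) => (~` hits h n l) `*` W n
  | inr k => ~` CN (mkseq (fun j => h (c 0%N j)) k) end.
have : compact (KX `*` KY) by exact: compact_setX.
rewrite (@compact_cover (X * Y)%type) => /(_ _ [set: nat * nat + nat] f)[||D _ cov].
- move=> [[n l]|k] _ /=.
    rewrite (_ : _ `*` _ = fst @^-1` (~` hits h n l) `&` snd @^-1` W n)//.
    apply: openI; apply: open_comp.
    + by move=> p _; exact: cvg_fst.
    + exact/closed_openC/hits_closed.
    + by move=> p _; exact: cvg_snd.
    + exact: bW.1.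
  exact/closed_openC.
- move=> [x y] [/= Kx Ky]; have [[k nk]|[n [l [nh Wy]]]] := branch_cover h _ _ Kx Ky.
    by exists (inr k).
  by exists (inl (n, l)).
(* [bd q] exceeds every code at which [f q] reads [h], so a prefix of length [N] determines all
   chosen open sets. *)
pose b (i l : nat) := (\max_(j < l) (c i j).+1)%N.
pose bd (q : nat * nat + nat) := match q with
  | inl (n, l) => b n.+1 l | inr k => b 0%N k end.
pose N := (\max_(q <- finmap.enum_fset D) bd q)%N.
have bdN q : q \in finmap.enum_fset D -> (bd q <= N)%N.
  by move=> qD; exact: (@leq_bigmax_seq _ (finmap.enum_fset D) xpredT bd q qD).
have pc i l j : (b i l <= N)%N -> (j <= l)%N -> piece i (mkseq h N) `<=`
    scheme i (mkseq (fun j => h (c i j)) j).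
  move=> bN jl p [g [gh gp]].
  suff -> : mkseq (fun j => h (c i j)) j = mkseq g j by exact: gp.
  apply/eq_in_map => j'; rewrite mem_iota add0n => /andP[_ j'j].
  have cN : (c i j' < N)%N.
    apply: leq_trans bN.
    exact: (@leq_bigmax _ (fun j : 'I_l => (c i j).+1)
      (Ordinal (leq_trans j'j jl))).
  by rewrite gh ?size_mkseq// nth_mkseq.
exists N, (fun n => \bigcup_(l in [set l | inl (n, l) \in finmap.enum_fset D]) ~` hits h n l).
split.
- move=> n; apply: sub_sigma_algebra; apply: bigcup_open => l _.
  exact/closed_openC/hits_closed.
- move=> n x y Kx [l /= lD nh] Ky Wy px; apply: nh.
  exists (x, y) => //; split => // j jl.
  by apply: (pc n.+1 l) => //; exact: (bdN (inl (n, l))).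
- move=> x y Kx Ky px.
  have [[[n l]|k] qD /=] := cov (x, y) (conj Kx Ky).
    by move=> [nh Wy]; exists n => //; exists l.
  by case; apply: (pc 0%N k k) => //; exact: (bdN (inr k)).
Qed.

(** Otherwise [good_step] extends bad sequences forever, giving a branch with only bad prefixes,
    against [branch_good]. *)
Let good_nil : good [::].
Proof.
apply: contrapT => bad.
have /choice[nx nxP] s : exists m, ~ good s -> ~ good (rcons s m).
  have [gs|bs] := pselect (good s); first by exists 0%N.
  apply: contrapT => nm; apply: bs; apply: good_step => m.
  by apply: contrapT => bm; apply: nm; exists m.
pose st k := iter k (fun s => rcons s (nx s)) [::].
have stE k : mkseq (fun k => nx (st k)) k = st k.
  by elim: k => // k IH; rewrite mkseqS IH.
have bst k : ~ good (st k) by elim: k => //= k IH; exact: nxP.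
by have [N] := branch_good (fun k => nx (st k)); rewrite stE; exact: bst.
Qed.

(** The section at [x] is empty exactly when the [W n] with [x] in [C n] cover [KY], and then
    finitely many do. Hence the set sought is a countable union, over finite lists whose [W n] cover
    [KY], of finite intersections of the [C n]. *)
Lemma novikov : exists2 C : set (g_sigma_algebraType (@open X)),
  measurable C & forall x, KX x -> C x <-> ~ exists2 y, KY y & E (x, y).
Proof.
have [C [mC CE' CN']] := good_nil.
pose U (k : nat) := if choice.unpickle k is Some s then
  if pselect (KY `<=` \bigcup_(n in [set` (s : seq nat)]) W n)
  then \bigcap_n (if n \in s then C n else setT) else set0 else set0.
exists (\bigcup_k U k).
  apply: bigcup_measurable => k _; rewrite /U.
  case: choice.unpickle => // s; case: (pselect (KY `<=` _)) => /= [?|?//].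
  by apply: bigcapT_measurable => n; case: ifP.
move=> x Kx; split.
  move=> [k _]; rewrite /U; case: choice.unpickle => // s.
  case: (pselect (KY `<=` _)) => //= cov Cx [y Ky Exy].
  have [n /= ns Wy] := cov _ Ky.
  have := Cx n I; rewrite ns => Cnx.
  apply: (CE' n x y) => //; first exact: subset_closure.
  by case: Exy => f fp; exists f; split.
move=> nE.
have := cKY; rewrite compact_cover => /(_ _ [set n | C n x] W)[||D sD cov].
- by move=> n _; exact: bW.1.
- move=> y Ky; have : (~` E) (x, y) by move=> Exy; apply: nE; exists y.
  rewrite EC => -[f fp]; have [|n Cx Wy] := CN' x y Kx Ky.
    by exists f; split.
  by exists n.
exists (choice.pickle (finmap.enum_fset D)) => //.
rewrite /U choice.pickleK; case: (pselect (KY `<=` _)) => //= ? n _.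
by case: ifPn => // /sD; rewrite inE.
Qed.

End novikov.

(** * Rational balls and Borel measurability for row vectors *)

Section row_vectors.
Context {R : realType} {n : nat}.

Definition rat_ball (k : nat) : set 'rV[R]_n :=
  if choice.unpickle k is Some q
  then ball (map_mx ratr (q : 'rV[rat]_n * nat).1 : 'rV[R]_n) (q.2.+1%:R^-1)
  else set0.

Lemma regular_base_rat_ball : regular_base rat_ball.
Proof.
split=> [k|x O /nbhs_ballP[e /= e0 xO]].
  rewrite /rat_ball; case: choice.unpickle => [q|]; last exact: open0.
  by apply: ball_open; rewrite invr_gt0.
(* A point of the closure is within one radius of a point of the ball, hence within two radii of the
   centre and three of [x]. *)
have e3 : 0 < e / 3 by rewrite divr_gt0.
have [j je] : exists j : nat, j.+1%:R^-1 < e / 3 :> R.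
  have [j _ ju] := near_infty_natSinv_lt (PosNum e3).
  by exists j; exact: (ju j (leqnn j)).
have j0 : 0 < j.+1%:R^-1 :> R by rewrite invr_gt0.
have /choice[q qx] (i : 'I_n) : exists q : rat, `|x ord0 i - ratr q| < j.+1%:R^-1.
  have [|q] := @rat_in_itvoo R (x ord0 i - j.+1%:R^-1) (x ord0 i + j.+1%:R^-1).
    by rewrite ltrD2l gtrN.
  by rewrite in_itv/= -ltr_distlC => ?; exists q.
pose c : 'rV[rat]_n := \row_i q i.
have cx : ball (map_mx ratr c : 'rV[R]_n) j.+1%:R^-1 x.
  split => // i1 i2; rewrite !mxE /ball /= distrC ord1; exact: qx.
exists (choice.pickle (c, j)); first by rewrite /rat_ball choice.pickleK.
rewrite /rat_ball choice.pickleK /= => y cy; apply: xO.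
have [z [cz yz]] := cy _ (nbhsx_ballx y _ j0).
apply: (@le_ball _ _ _ (j.+1%:R^-1 + (j.+1%:R^-1 + j.+1%:R^-1))).
  by move: je; set r := _^-1 => je; lra.
apply: (ball_triangle (y := (map_mx ratr c : 'rV[R]_n))); first exact: ball_sym.
by apply: (ball_triangle (y := z)) => //; exact: ball_sym.
Qed.

(** Open sets are countable unions of rational balls, and a ball of the sup norm is a finite
    intersection of conditions on coordinates. *)
Lemma measurable_fun_rV d (Omega : measurableType d) (f : Omega -> Borel R n) :
  (forall i, measurable_fun setT (fun w => (f w : 'rV[R]_n) ord0 i)) ->
  measurable_fun setT f.
Proof.
move=> mf; apply: (@measurability _ _ Omega (Borel R n) setT f (@open 'rV[R]_n) erefl).
move=> _ [U oU <-]; rewrite setTI.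
pose F k := if pselect (rat_ball k `<=` U) then rat_ball k else set0.
have -> : U = \bigcup_k F k.
  apply/seteqP; split => [x Ux|x [k _]]; last first.
    by rewrite /F; case: pselect => // sub; exact: sub.
  have [k Wx cW] := regular_base_rat_ball.2 _ _ (open_nbhs_nbhs (conj oU Ux)).
  exists k => //; rewrite /F.
  case: (pselect (rat_ball k `<=` U)) => //= nsub.
  by case: nsub; exact: subset_trans (@subset_closure _ _) cW.
rewrite preimage_bigcup; apply: bigcup_measurable => k _; rewrite /F.
case: (pselect (rat_ball k `<=` U)) => /= _; last by rewrite preimage_set0.
rewrite /rat_ball; case: choice.unpickle => [[q j]|]; last by rewrite preimage_set0.
have -> : f @^-1` ball (map_mx ratr q : 'rV[R]_n) (j.+1%:R^-1) =
  \bigcap_(i : 'I_n) (fun w => (f w : 'rV[R]_n) ord0 i) @^-1`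
     ball (ratr (q ord0 i) : R) (j.+1%:R^-1).
  apply/seteqP; split => [w [_ fw] i _ /=|w fw].
    by have := fw ord0 i; rewrite mxE.
  by split => [|i1 i]; rewrite ?invr_gt0// ord1 mxE; exact: (fw i I).
apply: fin_bigcap_measurable => // i _.
rewrite -[X in measurable X]setTI; apply: mf => //.
exact: measurable_ball.
Qed.

Lemma continuous_borel_measurable (f : 'rV[R]_n -> R) :
  continuous f -> measurable_fun setT (f : Borel R n -> R).
Proof.
move=> cf; apply: (measurability _ (RGenOpens.measurableE R)).
move=> _ [_ [a [b ->] <-]]; rewrite setTI; apply: sub_sigma_algebra.
by apply: open_comp => [x _|]; [exact: cf|exact: interval_open].
Qed.

Lemma open_borel_measurable (A : set 'rV[R]_n) :
  open A -> measurable (A : set (Borel R n)).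
Proof. by move=> oA; exact: sub_sigma_algebra. Qed.

End row_vectors.

(** Novikov's argument needs a compact base, so the space containing the values of [g] is exhausted
    by the closed balls [box l]. *)
Lemma measurable_projection {R : realType} {N m : nat} d
    (Omega : measurableType d) (g : Omega -> Borel R N)
    (E : set (Borel R N * Borel R m)) (K : set 'rV[R]_m) :
  measurable_fun setT g -> measurable E -> compact K ->
  (forall x : 'rV[R]_N, closed [set y : 'rV[R]_m | K y /\ E (x, y)]) ->
  measurable [set w | exists2 y, K y & E (g w, y)].
Proof.
move=> mg mE cK sE.
have [[CE clE EE] [CN clN EN]] :=
  measurable_bisuslin _ _ _ regular_base_rat_ball regular_base_rat_ball mE.
pose box (l : nat) := [set x : 'rV[R]_N | `|x| <= l%:R].
have cbox l : closed (box l).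
  rewrite (_ : box l = Num.norm @^-1` [set r : R | r <= l%:R])//.
  apply: preimage_closed; last exact: closed_le.
  by move=> x _; exact: norm_continuous.
have kbox l : compact (box l).
  apply: bounded_closed_compact => //; exists l%:R; split => //.
  by move=> M lM x /= xl; exact: le_trans xl (ltW lM).
have /choice[C CP] l : exists C : set (Borel R N), measurable C /\
    forall x, box l x -> C x <-> ~ exists2 y, K y & E (x, y).
  have [||x _|C mC CE'] := novikov _ (box l) K CE CN _ regular_base_rat_ball
    (kbox l) cK clE clN.
  - exact: norm_hausdorff.
  - by rewrite -EE.
  - by rewrite -EE; exact: sE.
  - by exists C; split => // x bx; rewrite EE; exact: CE'.
have -> : [set w | exists2 y, K y & E (g w, y)] =
    \bigcup_l (g @^-1` (box l `\` C l)).
  apply/seteqP; split => [w Ew|w [l _ [bw nC]]]; last first.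
    by apply: contrapT => nE; apply: nC; apply/(CP l).2.
  pose l := (Num.truncn `|g w : 'rV[R]_N|).+1.
  have bw : box l (g w) by rewrite /box /= ltW// truncnS_gt.
  by exists l => //; split => // /((CP l).2 _ bw); exact.
apply: bigcup_measurable => l _; rewrite -[X in measurable X]setTI.
apply: mg => //; apply: measurableD; last by have [] := CP l.
rewrite -[X in measurable X]setCK; apply: measurableC.
by apply: open_borel_measurable; exact: closed_openC.
Qed.

(** * A one-sided strong law of large numbers *)

Section independent_pair.
Context {R : realType} {d} {Omega : measurableType d} (P : probability Omega R).
Variables X Y : Omega -> R.
Hypotheses (mX : measurable_fun setT X) (mY : measurable_fun setT Y).

Let X' : {RV P >-> R} := HB.pack X (isMeasurableFun.Build _ _ _ _ X mX).
Let Y' : {RV P >-> R} := HB.pack Y (isMeasurableFun.Build _ _ _ _ Y mY).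
Let XY (w : Omega) := (X w, Y w).
Let mXY : measurable_fun setT XY.
Proof. exact: measurable_fun_pair. Qed.
Let XY' : {mfun Omega >-> (R * R)%type} :=
  HB.pack XY (isMeasurableFun.Build _ _ _ _ XY mXY).

(** Independence makes the joint law agree with the product law on rectangles, hence everywhere;
    Tonelli then factors the integral. *)
Lemma expectation_indep_prod (f : R -> R) :
  measurable_fun setT f -> (forall x, 0 <= f x) ->
  (forall A B, measurable A -> measurable B ->
    P (X @^-1` A `&` Y @^-1` B) = (P (X @^-1` A) * P (Y @^-1` B))%E) ->
  (\int[P]_w (f (X w) * f (Y w))%:E =
   \int[P]_w (f (X w))%:E * \int[P]_w (f (Y w))%:E)%E.
Proof.
move=> mf f0 ind.
pose g (p : R * R) := ((f p.1)%:E * (f p.2)%:E)%E.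
have mEf : measurable_fun setT (EFin \o f) by exact/measurable_EFinP.
have mg : measurable_fun setT g.
  by apply: emeasurable_funM; exact: (measurableT_comp mEf).
have g0 p : (0 <= g p)%E by rewrite mule_ge0// lee_fin.
transitivity (\int[pushforward P XY']_p g p)%E.
  by rewrite ge0_integral_pushforward.
transitivity (\int[distribution P X' \x distribution P Y']_p g p)%E.
  apply: eq_measure_integral => A mA _; apply/esym.
  by apply: product_measure_unique.
rewrite fubini_tonelli1//.
transitivity (\int[distribution P X']_x ((f x)%:E * \int[P]_w (f (Y w))%:E))%E.
  apply: eq_integral => x _; rewrite /fubini_F/g/= ge0_integralZl//; last 2 first.
  - by move=> y _; rewrite lee_fin.
  - by rewrite lee_fin.
  by rewrite ge0_integral_pushforward// ?preimage_setT// => y _; rewrite lee_fin.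
rewrite ge0_integralZr//; last 2 first.
- by move=> x _; rewrite lee_fin.
- by apply: integral_ge0 => w _; rewrite lee_fin.
by rewrite ge0_integral_pushforward// ?preimage_setT// => y _; rewrite lee_fin.
Qed.

Lemma expectation_same_law (f : R -> R) :
  measurable_fun setT f -> (forall x, 0 <= f x) ->
  (forall A, measurable A -> P (X @^-1` A) = P (Y @^-1` A)) ->
  (\int[P]_w (f (X w))%:E = \int[P]_w (f (Y w))%:E)%E.
Proof.
move=> mf f0 same.
have mEf : measurable_fun setT (EFin \o f) by exact/measurable_EFinP.
have push (U : {RV P >-> R}) :
    (\int[P]_w (f (U w))%:E = \int[pushforward P U]_x (f x)%:E)%E.
  by rewrite ge0_integral_pushforward// ?preimage_setT// => y _; rewrite lee_fin.
rewrite (push X') (push Y').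
by apply: eq_measure_integral => A mA _; exact: same.
Qed.

End independent_pair.

(** * Second moments of bounded random variables *)

Section bounded_random_variables.
Context {R : realType} {d} {Omega : measurableType d} (P : probability Omega R).
Implicit Types f g : Omega -> R.

Definition bounded_rv f :=
  measurable_fun setT f /\ exists M, forall w, `|f w| <= M.

Lemma bounded_rvD f g : bounded_rv f -> bounded_rv g -> bounded_rv (fun w => f w + g w).
Proof.
move=> [mf [M fM]] [mg [N gN]]; split; first exact: measurable_funD.
by exists (M + N) => w; apply: (le_trans (ler_normD _ _)); exact: lerD.
Qed.

Lemma bounded_rvM f g : bounded_rv f -> bounded_rv g -> bounded_rv (fun w => f w * g w).
Proof.
move=> [mf [M fM]] [mg [N gN]]; split; first exact: measurable_funM.
by exists (M * N) => w; rewrite normrM; exact: ler_pM.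
Qed.

Lemma bounded_rv_cst r : bounded_rv (fun=> r).
Proof. by split; [exact: measurable_cst|exists `|r|]. Qed.

Lemma bounded_rv_sum (F : nat -> Omega -> R) n :
  (forall i, bounded_rv (F i)) -> bounded_rv (fun w => \sum_(i < n) F i w).
Proof.
move=> bF; elim: n => [|n IH].
  rewrite (_ : (fun _ => _) = fun=> 0); first exact: bounded_rv_cst.
  by apply/funext => w; rewrite big_ord0.
rewrite (_ : (fun _ => _) = fun w => (\sum_(i < n) F i w) + F n w).
  exact: bounded_rvD.
by apply/funext => w; rewrite big_ord_recr.
Qed.

Lemma bounded_rv_integrable f : bounded_rv f -> P.-integrable setT (EFin \o f).
Proof.
move=> [mf [M fM]]; apply: measurable_bounded_integrable => //.
  by rewrite ltey_eq fin_num_measure.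
exists M; split; first exact: num_real.
by move=> N MN w _ /=; exact: le_trans (fM w) (ltW MN).
Qed.

Lemma Rintegral_sqr_sum_orthogonal (V : nat -> Omega -> R) (s : R) n :
  (forall i, bounded_rv (V i)) ->
  (forall i j, i <> j -> \int[P]_w (V i w * V j w) = 0) ->
  (forall i, \int[P]_w (V i w * V i w) <= s) ->
  \int[P]_w ((\sum_(i < n) V i w) * (\sum_(i < n) V i w)) <= n%:R * s.
Proof.
move=> bV orth Vs.
have cross k : (k <= n)%N -> forall j, (k <= j)%N ->
    \int[P]_w ((\sum_(i < k) V i w) * V j w) = 0.
  elim: k => [|k IH] kn j kj.
    under eq_Rintegral do rewrite big_ord0 mul0r.
    by rewrite Rintegral_cst// mul0r.
  under eq_Rintegral do rewrite big_ord_recr mulrDl.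
  rewrite RintegralD//=.
  - by rewrite IH ?(ltnW kn) ?(ltnW kj)// orth ?addr0// => kj'; rewrite kj' ltnn in kj.
  - by apply: bounded_rv_integrable; apply: bounded_rvM => //; exact: bounded_rv_sum.
  - by apply: bounded_rv_integrable; apply: bounded_rvM.
suff main k : (k <= n)%N -> \int[P]_w ((\sum_(i < k) V i w) * (\sum_(i < k) V i w)) <= k%:R * s.
  exact: main.
elim: k => [|k IH] kn.
  under eq_Rintegral do rewrite big_ord0 mul0r.
  by rewrite Rintegral_cst// !mul0r.
have bS := bounded_rv_sum V k bV.
pose S w := \sum_(i < k) V i w.
have -> : \int[P]_w ((\sum_(i < k.+1) V i w) * (\sum_(i < k.+1) V i w)) =
    \int[P]_w ((S w * S w + 2 * (S w * V k w)) + V k w * V k w).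
  by apply: eq_Rintegral => w _; rewrite big_ord_recr /= -/(S w); ring.
have bSS := bounded_rvM _ _ bS bS.
have bSV := bounded_rvM _ _ bS (bV k).
have b2SV := bounded_rvM _ _ (bounded_rv_cst 2) bSV.
have bVV := bounded_rvM _ _ (bV k) (bV k).
rewrite RintegralD//; last 2 first.
- by apply: bounded_rv_integrable; exact: bounded_rvD.
- exact: bounded_rv_integrable.
rewrite RintegralD//; try exact: bounded_rv_integrable.
rewrite RintegralZl//; last exact: bounded_rv_integrable.
rewrite cross ?mulr0 ?addr0 ?(ltnW kn)//.
by rewrite -natr1 mulrDl mul1r lerD// IH// ltnW.
Qed.

(** Chebyshev's inequality: [a * a] times the indicator of the event is at most [f * f]
    pointwise. *)
Lemma second_moment_tail f (a : R) : bounded_rv f -> 0 < a ->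
  (P [set w | (a <= f w)%R] <= (\int[P]_w (f w * f w) / (a * a))%R%:E)%E.
Proof.
move=> bf a0; have bff := bounded_rvM _ _ bf bf.
have mA : measurable [set w | a <= f w].
  rewrite -[X in measurable X]setTI (_ : mkset _ = f @^-1` `[a, +oo[).
    by apply: bf.1.
  by apply/seteqP; split => w /=; rewrite in_itv/= andbT.
have b1 : bounded_rv (\1_[set w | a <= f w] : Omega -> R).
  split; first exact: measurable_indic.
  by exists 1 => w; rewrite indicE; case: (_ \in _); rewrite ?normr1 ?normr0.
rewrite -[leLHS]fineK ?fin_num_measure// lee_fin ler_pdivlMr ?mulr_gt0//.
have -> : fine (P [set w | a <= f w]) = \int[P]_w (\1_[set w | a <= f w] w).
  by rewrite /Rintegral integral_indic// setIT.
rewrite mulrC -RintegralZl//; last exact: bounded_rv_integrable.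
apply: le_Rintegral => //.
- by apply: bounded_rv_integrable; apply: bounded_rvM => //; exact: bounded_rv_cst.
- exact: bounded_rv_integrable.
move=> w _; rewrite indicE; case: (boolP (w \in _)) => [|_].
  by rewrite inE /= mulr1 => aw; apply: ler_pM => //; exact: ltW.
by rewrite mulr0 -expr2 sqr_ge0.
Qed.

End bounded_random_variables.

(** * Truncated squares summed over doubling levels *)

Lemma sum_squares_geometric {R : realType} (x c : R) N : x <= c -> 0 < c -> 0 <= x ->
  \sum_(j < N) Num.min x (c * 2 ^+ j) ^+ 2 / (c * 2 ^+ j) <= 2 * (x ^+ 2 / c).
Proof.
move=> + + x0; elim: N c => [|N IH] c xc c0.
  by rewrite big_ord0 mulr_ge0// divr_ge0// ?sqr_ge0// ltW.
rewrite big_ord_recl expr0 mulr1 (min_idPl xc).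
rewrite (eq_bigr (fun j : 'I_N =>
  Num.min x (c * 2 * 2 ^+ j) ^+ 2 / (c * 2 * 2 ^+ j))); last first.
  by move=> j _; rewrite lift0 (exprS 2) mulrA.
have /IH H : x <= c * 2 by lra.
have {}H := H ltac:(by rewrite mulr_gt0).
apply: (le_trans (lerD (lexx _) H)).
by rewrite (invfM c) (mulrA (x ^+ 2)); lra.
Qed.

(** A level below [x] contributes itself, and such levels double; from the first level at least [x]
    on, the terms halve. Both geometric sums are at most [2 * x]. *)
Lemma sum_truncated_squares {R : realType} (x c : R) N : 0 <= x -> 0 < c ->
  \sum_(j < N) Num.min x (c * 2 ^+ j) ^+ 2 / (c * 2 ^+ j) <= 4 * x.
Proof.
move=> x0; have large c' M : x <= c' -> 0 < c' ->
    \sum_(j < M) Num.min x (c' * 2 ^+ j) ^+ 2 / (c' * 2 ^+ j) <= 2 * x.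
  move=> xc c0; apply: le_trans (sum_squares_geometric _ _ M xc c0 x0) _.
  by rewrite ler_pM2l// ler_pdivrMr// expr2 ler_wpM2l.
have [xc c0|] := leP x c; first by apply: le_trans (large _ N xc c0) _; lra.
(* The extra [- c] makes the induction close: the first term is [c], and the bound at the doubled
   level is [4 * x - c * 2]. *)
suff H : c < x -> 0 < c ->
    \sum_(j < N) Num.min x (c * 2 ^+ j) ^+ 2 / (c * 2 ^+ j) <= 4 * x - c.
  by move=> cx c0; apply: le_trans (H cx c0) _; rewrite gerBl ltW.
elim: N c => [|N IH] c cx c0; first by rewrite big_ord0; lra.
rewrite big_ord_recl expr0 mulr1 (min_idPr (ltW cx)).
rewrite expr2 mulfK ?gt_eqF//.
rewrite (eq_bigr (fun j : 'I_N =>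
  Num.min x (c * 2 * 2 ^+ j) ^+ 2 / (c * 2 * 2 ^+ j))); last first.
  by move=> j _; rewrite lift0 (exprS 2) mulrA.
have c2 : 0 < c * 2 by rewrite mulr_gt0.
have [xc|xc] := leP x (c * 2).
  by apply: (le_trans (lerD (lexx _) (large _ N xc c2))); lra.
by apply: (le_trans (lerD (lexx _) (IH _ xc c2))); lra.
Qed.

(** The gap between deviations 1/2 and 1 absorbs the factor [(r + 1) / r] lost by rounding a sample
    size up. *)
Lemma dyadic_slack {R : realFieldType} (r a : R) :
  2 * a + 1 <= r -> (r + 1) * (a + 2^-1) <= (a + 1) * r.
Proof.
move=> ra.
have -> : (r + 1) * (a + 2^-1) = a * r + (r / 2 + a + 2^-1) by field.
have -> : (a + 1) * r = a * r + r by ring.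
by rewrite lerD2l; lra.
Qed.

(** * Deviations along dyadic sample sizes and interpolation *)

Section law_of_large_numbers.
Context {R : realType} {d} {Omega : measurableType d} (P : probability Omega R).
Variable X : nat -> Omega -> R.
Hypotheses (mX : forall i, measurable_fun setT (X i)) (X0 : forall i w, 0 <= X i w).
Hypothesis indep : forall i j, i <> j -> forall A B, measurable A -> measurable B ->
  P (X i @^-1` A `&` X j @^-1` B) = (P (X i @^-1` A) * P (X j @^-1` B))%E.
Hypothesis same : forall i A, measurable A -> P (X i @^-1` A) = P (X 0%N @^-1` A).
Hypothesis intX : P.-integrable setT (EFin \o X 0%N).

Let mean := \int[P]_w X 0%N w.

Let mX_ge i (a : R) : measurable [set w | a <= X i w].
Proof.
rewrite -[X in measurable X]setTI (_ : mkset _ = X i @^-1` `[a, +oo[).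
  exact: mX.
by apply/seteqP; split => w /=; rewrite in_itv/= andbT.
Qed.

Let mSum n (a : R) : measurable [set w | a <= \sum_(i < n) X i w].
Proof.
rewrite -[X in measurable X]setTI
  (_ : mkset _ = (fun w => \sum_(i < n) X i w) @^-1` `[a, +oo[).
  by apply: measurable_sum => // i; exact: mX.
by apply/seteqP; split => w /=; rewrite in_itv/= andbT.
Qed.

Let second (n : nat) :=
  \int[P]_w (Num.min (X 0%N w) n%:R * Num.min (X 0%N w) n%:R).

(** Truncation at level [n] lowers the mean, which is harmless for an upper deviation. Chebyshev
    bounds the centred truncated sum and also the probability that some truncation takes effect,
    both by the truncated second moment. *)
Lemma truncated_tail n (e : R) : (0 < n)%N -> 0 < e ->
  (P [set w | (n%:R * (mean + e) <= \sum_(i < n) X i w)%R] <=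
   ((1 + (e * e)^-1) * (second n / n%:R))%R%:E)%E.
Proof.
move=> n0 e0; set K : R := n%:R; have K0 : 0 < K by rewrite /K ltr0n.
(* The maximum with 0 makes [t] nonnegative on the whole line, as the lemmas on expectations
   require; on values of [X] it changes nothing. *)
pose t (x : R) := Num.min (Num.max x 0) K.
have tX i w : t (X i w) = Num.min (X i w) K by rewrite /t (max_idPl (X0 i w)).
have mt : measurable_fun setT t by apply: measurable_minr => //; exact: measurable_maxr.
have t0 x : 0 <= t x by rewrite /t le_min le_max lexx orbT ltW.
have tK x : t x <= K by rewrite /t ge_min lexx orbT.
pose Y i w := t (X i w).
have bY i : bounded_rv (Y i).
  split; first exact: measurableT_comp.
  by exists K => w; rewrite /Y ger0_norm ?tK ?t0.
pose mu := \int[P]_w Y 0%N w.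
have EY i : \int[P]_w Y i w = mu.
  rewrite /mu /Rintegral; congr fine.
  exact: (expectation_same_law P (X i) (X 0%N) (mX i) (mX 0%N) t mt t0 (same i)).
have EYf i : (\int[P]_w (Y i w)%:E = mu%:E)%E.
  rewrite -(EY i) /Rintegral fineK//; apply: integrable_fin_num => //.
  exact: bounded_rv_integrable (bY i).
have s0 i : \int[P]_w (Y i w * Y i w) = second n.
  have -> : second n = \int[P]_w (Y 0%N w * Y 0%N w).
    by apply: eq_Rintegral => w _; rewrite /Y tX.
  rewrite /Rintegral; congr fine.
  have mt2 : measurable_fun setT (fun x => t x * t x) by exact: measurable_funM.
  exact: (expectation_same_law P (X i) (X 0%N) (mX i) (mX 0%N) _ mt2
    (fun x => mulr_ge0 (t0 x) (t0 x)) (same i)).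
have EYY i j : i <> j -> \int[P]_w (Y i w * Y j w) = mu * mu.
  move=> ij; rewrite /Rintegral.
  rewrite (expectation_indep_prod P (X i) (X j) (mX i) (mX j) t mt t0 (indep i j ij)).
  by rewrite (EYf i) (EYf j).
have mu_mean : mu <= mean.
  apply: le_Rintegral => //; first exact: bounded_rv_integrable (bY 0%N).
  by move=> w _; rewrite /Y tX ge_min lexx.
pose V i w := Y i w + - mu.
have bV i : bounded_rv (V i) by apply: bounded_rvD; [exact: bY|exact: bounded_rv_cst].
have EVV i j : \int[P]_w (V i w * V j w) = \int[P]_w (Y i w * Y j w) - mu * mu.
  transitivity (\int[P]_w ((Y i w * Y j w + - mu * Y i w) + (- mu * Y j w + mu * mu))).
    by apply: eq_Rintegral => w _; rewrite /V; ring.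
  have bYY := bounded_rvM _ _ (bY i) (bY j).
  have bm k := bounded_rvM _ _ (bounded_rv_cst (- mu)) (bY k).
  have bc := @bounded_rv_cst _ _ Omega (mu * mu).
  have bi := @bounded_rv_integrable _ _ _ P.
  rewrite RintegralD//; last 2 first.
  - by apply: bi; exact: bounded_rvD.
  - by apply: bi; exact: bounded_rvD.
  rewrite RintegralD//; try exact: bi.
  rewrite RintegralD//; try exact: bi.
  rewrite !RintegralZl//; try exact: bi; last by apply: bi; exact: bounded_rv_cst.
  have P1 : fine (P setT) = 1 by rewrite probability_setT.
  by rewrite Rintegral_cst// (EY i) (EY j) P1; ring.
have orth i j : i <> j -> \int[P]_w (V i w * V j w) = 0.
  by move=> ij; rewrite EVV EYY// subrr.
have EV2 i : \int[P]_w (V i w * V i w) <= second n.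
  by rewrite EVV s0 gerBl -expr2 sqr_ge0.
have sV := Rintegral_sqr_sum_orthogonal P V (second n) n bV orth EV2.
have bSV := bounded_rv_sum V n bV.
have H1 := second_moment_tail P _ (K * e) bSV (mulr_gt0 K0 e0).
(* [X i] reaches [K] exactly when its truncation does, so the truncated second moment controls this
   event too. *)
have H2 i : (P [set w | (K <= X i w)%R] <= (second n / (K * K))%R%:E)%E.
  have -> : P [set w | (K <= X i w)%R] = P [set w | (K <= Y i w)%R].
    congr (P _); apply/seteqP; split => w /=.
      by rewrite /Y tX le_min lexx andbT.
    by rewrite /Y tX le_min => /andP[].
  by have := second_moment_tail P _ K (bY i) K0; rewrite s0.
have sub : [set w | K * (mean + e) <= \sum_(i < n) X i w] `<=`
   [set w | K * e <= \sum_(i < n) V i w] `|`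
   \big[setU/set0]_(i < n) [set w | K <= X i w].
  move=> w /= Sw; have [[i Ki]|nK] := pselect (exists i : 'I_n, K <= X i w).
    by right; rewrite -bigcup_seq; exists i => //=; rewrite mem_index_enum.
  left; have YX i : (i < n)%N -> Y i w = X i w.
    move=> ilt; rewrite /Y tX; apply/min_idPl; rewrite leNgt; apply/negP => /ltW KX.
    by apply: nK; exists (Ordinal ilt).
  rewrite /V big_split/= sumr_const card_ord -mulr_natl -/K.
  rewrite (eq_bigr (fun i : 'I_n => X i w)); last by move=> i _; exact: YX.
  move: Sw; rewrite mulrDr; have : K * mu <= K * mean by rewrite ler_pM2l.
  by rewrite mulrN; lra.
have mSV : measurable [set w | K * e <= \sum_(i < n) V i w].
  rewrite -[X in measurable X]setTI
    (_ : mkset _ = (fun w => \sum_(i < n) V i w) @^-1` `[K * e, +oo[).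
    by apply: bSV.1.
  by apply/seteqP; split => w /=; rewrite in_itv/= andbT.
have mU : measurable (\big[setU/set0]_(i < n) [set w | K <= X i w]).
  by apply: bigsetU_measurable => i _; exact: mX_ge.
apply: (@le_trans _ _ (P ([set w | K * e <= \sum_(i < n) V i w] `|`
   \big[setU/set0]_(i < n) [set w | K <= X i w]))).
  by apply: le_measure; rewrite ?inE//; exact: measurableU.
apply: (le_trans (measureU2 _ mSV mU)).
have H3 : (P (\big[setU/set0]_(i < n) [set w | (K <= X i w)%R]) <=
    (second n / K)%R%:E)%E.
  apply: le_trans.
    by apply: (Boole_inequality P (A := fun i => [set w | K <= X i w])) => i _; exact: mX_ge.
  apply: (@le_trans _ _ (\sum_(i < n) (second n / (K * K))%R%:E)%E).
    by apply: lee_sum => i _; exact: H2.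
  rewrite sumEFin lee_fin sumr_const card_ord -mulr_natl -/K.
  by rewrite invfM mulrCA (mulrA K) mulfV ?gt_eqF// mul1r.
apply: (le_trans (leeD H1 H3)); rewrite -EFinD lee_fin mulrDl mul1r addrC lerD2l.
rewrite ler_pdivrMr ?mulr_gt0//.
apply: (le_trans sV); rewrite -/K.
rewrite (_ : _ * (K * e * (K * e)) = K * second n)//.
by field; rewrite !gt_eqF.
Qed.

Let big_dev (c j : nat) :=
  [set w | (c * 2 ^ j)%:R * (mean + 2^-1) <= \sum_(i < c * 2 ^ j) X i w].

(** Borel-Cantelli: the tail bounds are summed under the integral sign, where
    [sum_truncated_squares] bounds the sum pointwise by a multiple of the integrable [X 0]. *)
Lemma dyadic_deviations_null c : (0 < c)%N -> P (lim_sup_set (big_dev c)) = 0%E.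
Proof.
move=> c0; apply: lim_sup_set_cvg0; first by move=> j; exact: mSum.
have cR : 0 < c%:R :> R by rewrite ltr0n.
(* The factor 5 is [1 + (e * e)^-1] at [e = 2^-1]; the factor 4 comes from
   [sum_truncated_squares]. *)
apply: (@le_lt_trans _ _ (5 * (4 * mean))%:E); last exact: ltry.
apply: lime_le.
  by apply: is_cvg_nneseries => n _ _; exact: measure_ge0.
apply: nearW => N; rewrite big_mkord.
pose q j := second (c * 2 ^ j) / (c * 2 ^ j)%:R.
apply: (@le_trans _ _ (\sum_(j < N) (5 * q j)%:E)%E).
  apply: lee_sum => j _.
  have cj0 : (0 < c * 2 ^ j)%N by rewrite muln_gt0 c0 expn_gt0.
  have half0 : 0 < 2^-1 :> R by rewrite invr_gt0.
  apply: le_trans (truncated_tail _ _ cj0 half0) _; rewrite lee_fin.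
  by rewrite invfM invrK (_ : 1 + 2 * 2 = 5)//; lra.
rewrite sumEFin lee_fin -mulr_sumr ler_pM2l//.
pose m j w : R := Num.min (X 0%N w) (c%:R * 2 ^+ j).
have bm j : bounded_rv (m j).
  split; first by apply: measurable_minr => //; exact: mX.
  exists (c%:R * 2 ^+ j) => w; rewrite ger0_norm /m; first by rewrite ge_min lexx orbT.
  by rewrite le_min X0 mulr_ge0 ?exprn_ge0// ltW.
pose f j w : R := (c%:R * 2 ^+ j)^-1 * (m j w * m j w).
have bf j : bounded_rv (f j).
  by apply: bounded_rvM; [exact: bounded_rv_cst|exact: bounded_rvM].
have qE j : q j = \int[P]_w f j w.
  rewrite /f RintegralZl//; last exact: bounded_rv_integrable (bounded_rvM _ _ (bm j) (bm j)).
  by rewrite mulrC /q /second natrM natrX.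
have -> : \sum_(j < N) q j = \int[P]_w (\sum_(j < N) f j w).
  elim: N => [|N IH].
    rewrite big_ord0; under eq_Rintegral do rewrite big_ord0.
    by rewrite Rintegral_cst// mul0r.
  rewrite big_ord_recr /= IH qE; under [RHS]eq_Rintegral do rewrite big_ord_recr.
  rewrite RintegralD//; last exact: bounded_rv_integrable.
  by apply: bounded_rv_integrable; exact: bounded_rv_sum.
rewrite -RintegralZl//; apply: le_Rintegral => //.
- by apply: bounded_rv_integrable; exact: bounded_rv_sum.
- exact: (integrableZl measurableT 4 intX).
move=> w _; apply: le_trans (sum_truncated_squares _ _ N (X0 0%N w) cR).
apply: ler_sum => j _; by rewrite /f /m -expr2 mulrC.
Qed.

(** A large [n] is rounded up to a controlled size [c.+1 * 2 ^ j] at relative cost at most [1 / q];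
    partial sums only grow, since the summands are nonnegative. *)
Lemma average_eventually_le : exists A : set Omega, measurable A /\ P A = 1%E /\
  forall w, A w -> exists N, forall n, (N <= n)%N ->
    \sum_(i < n) X i w <= n%:R * (mean + 1).
Proof.
have mL c : measurable (lim_sup_set (big_dev c)).
  apply: bigcapT_measurable => n; apply: bigcup_measurable => j _; exact: mSum.
have mU : measurable (\bigcup_c lim_sup_set (big_dev c.+1)).
  by apply: bigcup_measurable => c _; exact: mL.
exists (~` \bigcup_c lim_sup_set (big_dev c.+1)); split; first exact: measurableC.
split.
  rewrite probability_setC//.
  suff -> : P (\bigcup_c lim_sup_set (big_dev c.+1)) = 0%E by rewrite sube0.
  apply/eqP; rewrite eq_le measure_ge0 andbT.
  apply: (le_trans (measure_sigma_subadditive _ _ mU (fun x h => h))).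
    by move=> c; exact: mL.
  by rewrite eseries0// => c _ _; exact: dyadic_deviations_null.
move=> w nw.
have mean0 : 0 <= mean by apply: Rintegral_ge0 => w' _; exact: X0.
have /choice[J JP] c : exists J, forall j, (J <= j)%N ->
    \sum_(i < c.+1 * 2 ^ j) X i w <= (c.+1 * 2 ^ j)%:R * (mean + 2^-1).
  apply: contrapT => nJ; apply: nw; exists c => // J _.
  apply: contrapT => nb; apply: nJ; exists J => j Jj.
  rewrite leNgt; apply/negP => lt; apply: nb; exists j => //; exact: ltW.
(* The threshold is the hypothesis of [dyadic_slack] with [a = mean]. *)
pose q := (Num.truncn (2 * mean + 1)).+1.
have q2 : 2 * mean + 1 <= q%:R by rewrite ltW// truncnS_gt.
have q0 : (0 < q)%N by [].
pose Jm := (\max_(c < 2 * q) J c)%N.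
exists (q * 2 ^ Jm)%N => n nN.
pose j := trunc_log 2 (n %/ q)%N.
have qn : (2 ^ Jm <= n %/ q)%N by rewrite leq_divRL// mulnC.
have nq0 : (0 < n %/ q)%N by apply: leq_trans qn; rewrite expn_gt0.
have Jj : (Jm <= j)%N by exact: trunc_log_max.
have /andP[j1 j2] : (2 ^ j <= n %/ q < 2 ^ j.+1)%N by exact: trunc_log_bounds.
have qjn : (q * 2 ^ j <= n)%N by move: j1; rewrite leq_divRL// mulnC.
have njq : (n < 2 * q * 2 ^ j)%N.
  by move: j2; rewrite ltn_divLR// expnS mulnAC.
(* The choice of [j] keeps [c] below [2 * q], so the finitely many thresholds [J c] have the common
   bound [Jm]. *)
pose c := (n %/ 2 ^ j)%N.
have c2q : (c < 2 * q)%N by rewrite /c ltn_divLR ?expn_gt0.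
have Jc : (J c <= j)%N.
  apply: leq_trans Jj.
  exact: (@leq_bigmax _ (fun c : 'I_(2 * q) => J c) (Ordinal c2q)).
have nk : (n <= c.+1 * 2 ^ j)%N by rewrite ltnW// ltn_ceil// expn_gt0.
have kn : (c.+1 * 2 ^ j <= n + 2 ^ j)%N.
  by rewrite mulSn addnC leq_add2r leq_divM.
apply: (@le_trans _ _ (\sum_(i < c.+1 * 2 ^ j) X i w)).
  rewrite -!(big_mkord xpredT (fun i => X i w)) (big_cat_nat (leq0n n) nk)//=.
  by rewrite lerDl sumr_ge0.
apply: (le_trans (JP _ _ Jc)).
have kR : (c.+1 * 2 ^ j)%:R * q%:R <= n%:R * (q%:R + 1) :> R.
  rewrite natr1 -!natrM ler_nat.
  apply: (@leq_trans ((n + 2 ^ j) * q)); first by rewrite leq_mul2r kn orbT.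
  by rewrite mulnDl mulnS addnC leq_add2r mulnC.
have qR : 0 < q%:R :> R by rewrite ltr0n.
rewrite -(ler_pM2r qR) mulrAC.
apply: (@le_trans _ _ (n%:R * (q%:R + 1) * (mean + 2^-1))).
  by apply: ler_wpM2r kR; rewrite addr_ge0// invr_ge0.
rewrite -!mulrA ler_wpM2l//; exact: dyadic_slack.
Qed.

End law_of_large_numbers.

(** * Lower semicontinuity and the convex conjugate *)

Section lsc_on.
Context {T : topologicalType} {R : realType}.
Implicit Types (D K : set T) (f g : T -> R).

(** Relative lower semicontinuity expressed with neighbourhoods of the ambient space, to which
    filter arguments apply directly. *)
Definition lsc_on D f :=
  forall x, D x -> forall a, a < f x -> nbhs x [set y | D y -> a < f y].

Lemma lsc_onP D f :
  lsc_on D f <-> @lower_semicontinuous (subspace D) R (fun x => (f x)%:E).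
Proof.
split=> [lf x a|lf x Dx a afx].
  rewrite lte_fin => afx; have [Dx|nDx] := pselect (D x).
    exists [set y | D y /\ a < f y]; last by move=> y []; rewrite lte_fin.
    case: _ / (nbhs_subspaceP D x) => // _.
    by apply: filterS (lf x Dx a afx) => y Dfy Dy; split => //; exact: Dfy.
  (* Points outside [D] are isolated in the subspace topology. *)
  exists [set x]; last by move=> y ->; rewrite lte_fin.
  by case: _ / (nbhs_subspaceP D x) => [//|_ y].
have [|V + Vf] := lf x a; first by rewrite lte_fin.
case: _ / (nbhs_subspaceP D x) => // _.
rewrite withinE => -[W xW WV]; apply: filterS xW => y Wy Dy.
by rewrite -lte_fin; apply: Vf; have [] : (V `&` D) y by rewrite WV.
Qed.

Lemma lsc_onD D f g : lsc_on D f -> lsc_on D g -> lsc_on D (fun x => f x + g x).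
Proof.
move=> lf lg x Dx a afg; pose e := (f x + g x - a) / 2.
have e0 : 0 < e by rewrite /e; lra.
have Hf := lf x Dx (f x - e) ltac:(lra).
have Hg := lg x Dx (g x - e) ltac:(lra).
apply: filterS2 Hf Hg => y Hf Hg Dy.
by move: (Hf Dy) (Hg Dy); rewrite /e; lra.
Qed.

Lemma lsc_on_cst D r : lsc_on D (fun=> r).
Proof. by move=> x Dx a ar; apply: filterS filterT => y _. Qed.

Lemma lsc_on_sum D (F : nat -> T -> R) n :
  (forall i, lsc_on D (F i)) -> lsc_on D (fun x => \sum_(i < n) F i x).
Proof.
move=> lF; elim: n => [|n IH].
  rewrite (_ : (fun _ => _) = fun=> 0); first exact: lsc_on_cst.
  by apply/funext => w; rewrite big_ord0.
rewrite (_ : (fun _ => _) = fun w => (\sum_(i < n) F i w) + F n w).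
  exact: lsc_onD.
by apply/funext => w; rewrite big_ord_recr.
Qed.

Lemma lsc_onZ D r f : 0 < r -> lsc_on D f -> lsc_on D (fun x => r * f x).
Proof.
move=> r0 lf x Dx a; rewrite mulrC -ltr_pdivrMr// => afx.
apply: filterS (lf x Dx _ afx) => y Hf Dy.
by rewrite mulrC -ltr_pdivrMr//; exact: Hf.
Qed.

Lemma continuous_lsc_on D f : continuous f -> lsc_on D f.
Proof.
move=> cf x Dx a afx.
have : nbhs x [set y | a < f y].
  by apply: (cf x [set r | a < r]); apply: open_nbhs_nbhs; split => //; exact: open_gt.
by move=> h; apply: filterS h => y ay _.
Qed.

Lemma lsc_on_closed_sublevel D K f (a : R) : K `<=` D -> closed K -> lsc_on D f ->
  closed [set x | K x /\ f x <= a].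
Proof.
move=> KD cK lf; rewrite -openC openE => x /= nx.
have [Kx|nKx] := pselect (K x); last first.
  have : nbhs x (~` K) by apply: open_nbhs_nbhs; split => //; exact: closed_openC.
  by apply: filterS => y nKy [].
have afx : a < f x by rewrite ltNge; apply/negP => fxa; apply: nx.
apply: filterS (lf x (KD _ Kx) _ afx) => y afy [Ky].
by rewrite leNgt afy//; exact: KD.
Qed.

(** The sublevel sets at values of [f] generate a proper filter. A cluster point is a minimizer:
    near a point with larger value than [f r], the sublevel set of [f r] would be missed. *)
Lemma lsc_on_min K f : compact K -> K !=set0 -> lsc_on K f ->
  exists2 x, K x & forall y, K y -> f x <= f y.
Proof.
move=> cK [x0 Kx0] lf.
pose F := filter_from K (fun r => [set q | K q /\ f q <= f r]).
have FF : ProperFilter F.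
  apply: filter_from_proper; last by move=> r Kr; exists r.
  apply: filter_from_filter; first by exists x0.
  move=> r s Kr Ks; have [rs|sr] := leP (f r) (f s).
    by exists r => // q [Kq qr]; split; split => //; exact: le_trans qr rs.
  by exists s => // q [Kq qs]; split; split => //; exact: le_trans qs (ltW sr).
have FK : F K by exists x0 => // q [].
have [x [Kx clx]] := cK F FF FK; exists x => // r Kr.
rewrite leNgt; apply/negP => /(lf x Kx) nb.
have Fr : F [set q | K q /\ f q <= f r] by exists r.
have [q [[Kq qr] /(_ Kq)]] := clx _ _ Fr nb.
by rewrite ltNge qr.
Qed.

End lsc_on.

Lemma lsc_on_comp {S T : topologicalType} {R : realType} (D : set S) (h : T -> S)
    (f : S -> R) :
  continuous h -> lsc_on D f -> lsc_on (h @^-1` D) (fun x => f (h x)).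
Proof. by move=> ch lf x Dx a afx; exact: ch _ _ (lf (h x) Dx a afx). Qed.

Lemma lsc_on_subset {T : topologicalType} {R : realType} (D E : set T) (f : T -> R) :
  E `<=` D -> lsc_on D f -> lsc_on E f.
Proof.
by move=> ED lf x Ex a afx; apply: filterS (lf x (ED _ Ex) a afx) => y H /ED.
Qed.

(** * The conjugate as a supremum of affine functions of nonnegative slope *)

Section conjugate.
Context {R : realType} (Phi : R -> \bar R).
Hypothesis Phi_ge0 : forall x : R, 0 <= x -> (0 <= Phi x)%E.
Hypothesis Phi0_fin : (Phi 0%R < +oo)%E.
Hypothesis Phi_growth : (fun x : R => (Phi x * (x^-1)%:E)%E) x @[x --> +oo] --> +oo%E.

Let phi y := fine (conj_fun Phi y).

Let Phi_fin s : 0 <= s -> (Phi s < +oo)%E -> Phi s = (fine (Phi s))%:E.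
Proof. by move=> s0 sfin; rewrite fineK// ge0_fin_numE// Phi_ge0. Qed.

(** Superlinear growth makes [x * y - Phi x] nonpositive for large [x], so only a bounded range of
    [x] matters for the upper bound; [x = 0] gives the lower bound. *)
Lemma conj_fun_fin y : conj_fun Phi y \is a fin_num.
Proof.
rewrite fin_real//; apply/andP; split.
  apply: (@lt_le_trans _ _ ((0 * y)%:E - Phi 0)%E).
    by rewrite (Phi_fin 0)// -EFinB ltNyr.
  by apply: ereal_sup_ubound; exists 0 => //=.
have /cvgeyPge/(_ `|y|)[M [Mreal PM]] := Phi_growth.
pose M' := Num.max M 0.
apply: (@le_lt_trans _ _ (M' * `|y|)%:E); last exact: ltry.
apply: ge_ereal_sup => _ [x /= x0 <-].
have M'0 : 0 <= M' by rewrite le_max lexx orbT.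
have [xM|Mx] := leP x M'.
  apply: (@le_trans _ _ (x * y)%:E).
    by apply: (le_trans (leeB (lexx _) (Phi_ge0 x x0))); rewrite sube0.
  rewrite lee_fin; apply: (@le_trans _ _ (x * `|y|)).
    by rewrite ler_wpM2l// ler_norm.
  by rewrite ler_wpM2r.
apply: (@le_trans _ _ 0%E); last by rewrite lee_fin mulr_ge0.
have [MltX xpos] : M < x /\ 0 < x by move: Mx; rewrite gt_max => /andP.
have := PM x MltX; have := Phi_ge0 x x0; case: (Phi x) => [r| |]//=.
move=> _; rewrite -EFinM !lee_fin ler_pdivlMr// => yr.
rewrite subr_le0; apply: le_trans yr; rewrite mulrC.
by rewrite ler_wpM2r// ler_norm.
Qed.

Lemma conj_fun_affine_le s y : 0 <= s -> (Phi s < +oo)%E ->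
  s * y - fine (Phi s) <= phi y.
Proof.
move=> s0 sfin; rewrite -lee_fin fineK ?conj_fun_fin// EFinB -Phi_fin//.
by apply: ereal_sup_ubound; exists s.
Qed.

(** The witness is an affine minorant of the conjugate with slope [s >= 0]; monotonicity and lower
    semicontinuity both rest on that sign. *)
Lemma conj_fun_affine_gt a y : a < phi y ->
  exists s, [/\ 0 <= s, (Phi s < +oo)%E & a < s * y - fine (Phi s)].
Proof.
rewrite -lte_fin fineK ?conj_fun_fin// => /ereal_sup_gt[_ [s /= s0 <-]] lt.
have sfin : (Phi s < +oo)%E.
  by rewrite ltey; apply/eqP => Py; move: lt; rewrite Py.
by exists s; split => //; rewrite -lte_fin EFinB -Phi_fin.
Qed.

Lemma conj_fun_nondecreasing y y' : y <= y' -> phi y <= phi y'.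
Proof.
move=> yy'; rewrite leNgt; apply/negP => /conj_fun_affine_gt[s [s0 sfin lt]].
have := conj_fun_affine_le s y' s0 sfin.
have : s * y <= s * y' by rewrite ler_wpM2l.
lra.
Qed.

(** A lower bound on [g] passes through an affine minorant of nonnegative slope. Slope 0 is treated
    apart because the threshold for [g] divides by [s]. *)
Lemma lsc_on_conj_fun {T : topologicalType} (D : set T) (g : T -> R) :
  lsc_on D g -> lsc_on D (fun x => phi (g x)).
Proof.
move=> lg x Dx a /conj_fun_affine_gt[s [s0 sfin lt]].
move: (s0); rewrite le_eqVlt => /predU1P[s0'|sp].
  apply: filterS filterT => y _ _.
  have e : s * g x = s * g y by rewrite -s0' !mul0r.
  by rewrite e in lt; apply: lt_le_trans lt _; exact: conj_fun_affine_le.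
have lt' : (a + fine (Phi s)) / s < g x by rewrite ltr_pdivrMr// mulrC; lra.
apply: filterS (lg x Dx _ lt') => y H Dy; move: (H Dy).
rewrite ltr_pdivrMr// mulrC => H'.
by apply: lt_le_trans (conj_fun_affine_le s (g y) s0 sfin); lra.
Qed.

Lemma measurable_conj_fun : measurable_fun setT phi.
Proof.
apply/measurable_EFinP; apply: lower_semicontinuous_measurable.
have lid : lsc_on setT (fun x : R => x).
  by apply: continuous_lsc_on => x; exact: cvg_id.
move=> x a; rewrite lte_fin => afx.
exists [set y | a < phi y]; last by move=> y; rewrite lte_fin.
by apply: filterS (lsc_on_conj_fun setT _ lid x I a afx) => y; exact.
Qed.

End conjugate.

(** * The empirical objective *)

Section empirical_objective.
Context {R : realType} {m d : nat}.
Variables (Theta : set 'rV[R]_m) (G : 'rV[R]_m -> 'rV[R]_d -> R) (Phi : R -> \bar R).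
Variables (xi1 xi2 : 'rV[R]_d -> R) (x0 : R).
Hypotheses (Theta0 : Theta !=set0) (cTheta : compact Theta).
Hypothesis Phi_ge0 : forall x : R, 0 <= x -> (0 <= Phi x)%E.
Hypothesis Phi0_fin : (Phi 0%R < +oo)%E.
Hypothesis Phi_growth : (fun x : R => (Phi x * (x^-1)%:E)%E) x @[x --> +oo] --> +oo%E.
Hypotheses (x0_gt1 : 1 < x0) (Phix0_fin : (Phi x0 < +oo)%E).
Hypothesis lscG : forall z, lsc_on Theta (fun th => G th z).
Hypothesis xi1P : forall th z, Theta th -> `|G th z| <= xi1 z.
Hypothesis xi2P : forall th z, Theta th -> (`|conj_fun Phi (G th z)| <= (xi2 z)%:E)%E.

Let phi y := fine (conj_fun Phi y).

(** [Xn] as a function of the sample instead of the outcome, so that it can also be evaluated on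
    arbitrary sample vectors. *)
Definition objective n (z : nat -> 'rV[R]_d) (p : 'rV[R]_m * R) : R :=
  n%:R^-1 * \sum_(i < n) (fine (conj_fun Phi (G p.1 (z i) + p.2)) - p.2).

Let avg n (u : nat -> R) := n%:R^-1 * \sum_(i < n) u i.

Let avg_le n u v : (forall i, u i <= v i) -> avg n u <= avg n v.
Proof. by move=> uv; rewrite ler_wpM2l ?invr_ge0// ler_sum. Qed.

Let avg_affine n (a b : R) u : (0 < n)%N ->
  avg n (fun i => a * u i + b) = a * avg n u + b.
Proof.
move=> n0; rewrite /avg big_split/= -mulr_sumr sumr_const card_ord mulrDr mulrCA.
by rewrite -[b *+ n]mulr_natl mulKf// pnatr_eq0 -lt0n.
Qed.

Lemma objective_at0_le n z th : (0 < n)%N -> Theta th ->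
  objective n z (th, 0) <= avg n (fun i => xi2 (z i)).
Proof.
move=> n0 Tth; apply: (avg_le n (fun i => phi (G th (z i) + 0) - 0)) => i.
rewrite subr0 addr0; apply: (le_trans (ler_norm _)); rewrite -lee_fin.
have := xi2P th (z i) Tth.
by rewrite -{1}(fineK (conj_fun_fin Phi Phi_ge0 Phi0_fin Phi_growth (G th (z i)))).
Qed.

(** Uses the minorant of the conjugate with slope 0. *)
Lemma objective_ge_left n z th x : (0 < n)%N ->
  - fine (Phi 0) - x <= objective n z (th, x).
Proof.
move=> n0; have <- : avg n (fun i => 0 * 0 + (- fine (Phi 0) - x)) = - fine (Phi 0) - x.
  by rewrite (avg_affine n 0 _ (fun=> 0)) // mul0r add0r.
apply: (avg_le n _ (fun i => phi (G th (z i) + x) - x)) => i.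
have := conj_fun_affine_le Phi Phi_ge0 Phi0_fin Phi_growth 0 (G th (z i) + x)
  (lexx _) Phi0_fin.
by rewrite !mul0r !add0r lerD2r.
Qed.

(** Uses the minorant with slope [x0], together with [G >= - xi1]. *)
Lemma objective_ge_right n z th x : (0 < n)%N -> Theta th ->
  (x0 - 1) * x - x0 * avg n (fun i => xi1 (z i)) - fine (Phi x0) <=
  objective n z (th, x).
Proof.
move=> n0 Tth; have -> : (x0 - 1) * x - x0 * avg n (fun i => xi1 (z i)) - fine (Phi x0)
   = avg n (fun i => - x0 * xi1 (z i) + ((x0 - 1) * x - fine (Phi x0))).
  by rewrite avg_affine//; ring.
apply: (avg_le n _ (fun i => phi (G th (z i) + x) - x)) => i.
have x0_ge0 : 0 <= x0 by exact: ltW (lt_trans ltr01 x0_gt1).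
have H := conj_fun_affine_le Phi Phi_ge0 Phi0_fin Phi_growth x0 (G th (z i) + x)
  x0_ge0 Phix0_fin.
have : - xi1 (z i) <= G th (z i).
  by have := xi1P th (z i) Tth; rewrite ler_norml => /andP[].
move=> /(ler_wpM2l x0_ge0) H2.
rewrite -/(phi _) in H.
apply: (@le_trans _ _ (x0 * (G th (z i) + x) - fine (Phi x0) - x)); last first.
  by rewrite lerD2r.
by move: H2; rewrite mulrN mulNr mulrDr; lra.
Qed.

(** The two lines are compared with the level. When the sample means exceed the expectations by at
    most 1, the ends become those of the interval in the theorem. *)
Lemma objective_sublevel n z th x : (0 < n)%N -> Theta th ->
  objective n z (th, x) <= avg n (fun i => xi2 (z i)) ->
  - fine (Phi 0) - avg n (fun i => xi2 (z i)) <= x <=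
  (fine (Phi x0) + avg n (fun i => xi2 (z i)) + x0 * avg n (fun i => xi1 (z i))) / (x0 - 1).
Proof.
move=> n0 Tth ob; have := objective_ge_left n z th x n0.
have := objective_ge_right n z th x n0 Tth.
move: ob; set a2 := avg n _; set a1 := avg n _; set o := objective _ _ _ => h1 h2 h3.
rewrite ler_pdivlMr ?subr_gt0// [x * _]mulrC; apply/andP; split; lra.
Qed.

Lemma lsc_on_objective n z : (0 < n)%N -> lsc_on (Theta `*` setT) (objective n z).
Proof.
move=> n0; apply: lsc_onZ; first by rewrite invr_gt0 ltr0n.
apply: (lsc_on_sum _ (fun i (p : 'rV[R]_m * R) => phi (G p.1 (z i) + p.2) - p.2)) => i.
apply: lsc_onD; last first.
  by apply: continuous_lsc_on => p; apply: cvgN; exact: cvg_snd.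
apply: lsc_on_conj_fun => //; apply: lsc_onD; last first.
  by apply: continuous_lsc_on => p; exact: cvg_snd.
apply: (@lsc_on_subset _ _ (fst @^-1` Theta)); first by move=> p [].
apply: (lsc_on_comp Theta fst (fun th => G th (z i))) => //.
by move=> p; exact: cvg_fst.
Qed.

(** A minimum over [Theta] times the compact interval is global: the strip contains the points with
    [x = 0], whose values are at most [a2], while outside it the objective exceeds [a2]. *)
Lemma objective_argmin n z : (0 < n)%N -> exists2 p : 'rV[R]_m * R,
  (Theta `*` setT) p & forall q, (Theta `*` setT) q -> objective n z p <= objective n z q.
Proof.
move=> n0; set a2 := avg n (fun i => xi2 (z i)).
set l := - fine (Phi 0) - a2.
set u := (fine (Phi x0) + a2 + x0 * avg n (fun i => xi1 (z i))) / (x0 - 1).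
have inside th x : Theta th -> objective n z (th, x) <= a2 -> (l <= x <= u).
  exact: objective_sublevel.
have at0 th (Tth : Theta th) := objective_at0_le n z th n0 Tth.
have [|||p [Tp _] pmin] := @lsc_on_min _ _ (Theta `*` `[l, u]) (objective n z).
- by apply: compact_setX => //; exact: segment_compact.
- have [th Tth] := Theta0; exists (th, 0); split => //=.
  by rewrite in_itv/=; apply: inside Tth (at0 th Tth).
- by apply: lsc_on_subset (lsc_on_objective n z n0) => p [].
exists p => // -[th x] [/= Tth _].
have [xa2|a2x] := leP (objective n z (th, x)) a2.
  by apply: pmin; split => //=; rewrite in_itv/=; exact: inside Tth xa2.
apply: le_trans (ltW a2x); apply: le_trans (at0 th Tth).
by apply: pmin; split => //=; rewrite in_itv/=; exact: inside Tth (at0 th Tth).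
Qed.

(* Moving x to the left by h raises the objective by at most h, because the
   conjugate is nondecreasing; this is what makes rational x sufficient. *)
Lemma objective_shift n z th x y : (0 < n)%N -> y <= x ->
  objective n z (th, y) <= objective n z (th, x) + (x - y).
Proof.
move=> n0 yx; rewrite -[objective n z (th, x)]mul1r.
rewrite -(avg_affine n 1 (x - y) (fun i => phi (G th (z i) + x) - x)) //.
apply: (avg_le n (fun i => phi (G th (z i) + y) - y)) => i.
have := conj_fun_nondecreasing Phi Phi_ge0 Phi0_fin Phi_growth
  (G th (z i) + y) (G th (z i) + x).
by rewrite lerD2l => /(_ yx); rewrite /phi; lra.
Qed.

(** * Measurability of the epigraph events *)

Section measurability.
Context {dO} {Omega : measurableType dO} (Z : nat -> Omega -> 'rV[R]_d) (n : nat).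
Hypothesis n_gt0 : (0 < n)%N.
Hypothesis mZ : forall i, measurable_fun [set: Omega] (Z i : Omega -> Borel R d).
Hypothesis mG : measurable_fun (Theta `*` setT : set (Borel R m * Borel R d))
  (fun p => G p.1 p.2).

Let closed_Theta : closed Theta.
Proof. by apply: compact_closed => //; exact: norm_hausdorff. Qed.

Let mTheta : measurable (Theta : set (Borel R m)).
Proof.
rewrite -[X in measurable X]setCK; apply: measurableC.
by apply: open_borel_measurable; exact: closed_openC.
Qed.

(** The first [n] sample points as one Euclidean vector: the projection theorem works in this space,
    and the result is pulled back to [Omega]. *)
Let stack (w : Omega) : Borel R (n * d) := mxvec (\matrix_(i < n, j < d) Z i w ord0 j).
Let unstack (i : 'I_n) (v : Borel R (n * d)) : Borel R d :=
  row i (vec_mx (v : 'rV[R]_(n * d))).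

Let unstackK i w : unstack i (stack w) = Z i w.
Proof. by rewrite /unstack /stack mxvecK; apply/rowP => j; rewrite !mxE. Qed.

Let measurable_coord k (i : 'I_k) :
  measurable_fun setT (fun v : Borel R k => (v : 'rV[R]_k) ord0 i).
Proof. by apply: continuous_borel_measurable; exact: coord_continuous. Qed.

Let measurable_stack : measurable_fun setT stack.
Proof.
apply: measurable_fun_rV => k; case/mxvec_indexP: k => i j.
rewrite (_ : (fun _ => _) = fun w => Z i w ord0 j).
  exact: (measurableT_comp (measurable_coord d j) (mZ i)).
by apply/funext => w; rewrite /stack mxvecE mxE.
Qed.

Let measurable_unstack i : measurable_fun setT (unstack i).
Proof.
apply: measurable_fun_rV => j.
rewrite (_ : (fun _ => _) = fun v => (v : 'rV[R]_(n * d)) ord0 (mxvec_index i j)).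
  exact: measurable_coord.
by apply/funext => v; rewrite /unstack !mxE.
Qed.

(** [G] is replaced by a default value outside [Theta], so that joint measurability holds on the
    whole product space. *)
Let stacked_objective (q : R) (p : Borel R (n * d) * Borel R m) : R :=
  n%:R^-1 * \sum_(i < n) (phi ((G ^~ (unstack i p.1) \_ Theta) p.2 + q) - q).

Let measurable_stacked_objective q : measurable_fun setT (stacked_objective q).
Proof.
apply: measurable_funM => //; apply: measurable_sum => i; apply: measurable_funB => //.
apply: (measurableT_comp (measurable_conj_fun Phi Phi_ge0 Phi0_fin Phi_growth)).
apply: measurable_funD => //.
pose h (p : Borel R (n * d) * Borel R m) : Borel R m * Borel R d := (p.2, unstack i p.1).
have mh : measurable_fun setT h.
  by apply: measurable_fun_pair => //; exact: measurableT_comp.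
have mT : measurable (Theta `*` setT : set (Borel R m * Borel R d)).
  exact: measurableX.
have mGr := (measurable_restrictT _ mT).1 mG.
rewrite (_ : (fun _ => _) = ((fun p => G p.1 p.2) \_ (Theta `*` setT)) \o h).
  exact: measurableT_comp.
apply/funext => p /=; rewrite /patch /h/=.
have -> : ((p.2, unstack i p.1) \in Theta `*` setT) = (p.2 \in Theta).
  by apply/idP/idP; rewrite !inE; [case|split].
by [].
Qed.

(** The sections to be projected are sublevel sets of a lower semicontinuous function in a compact
    set, hence closed. *)
Let measurable_slice (q r : R) (K : set 'rV[R]_m) : compact K -> K `<=` Theta ->
  measurable [set w | exists2 th, K th & objective n (Z ^~ w) (th, q) <= r].
Proof.
move=> cK KT.
have cl : closed K by apply: compact_closed => //; exact: norm_hausdorff.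
pose E := [set p : Borel R (n * d) * Borel R m | stacked_objective q p <= r].
have mE : measurable E.
  rewrite -[X in measurable X]setTI (_ : E = stacked_objective q @^-1` `]-oo, r]).
    exact: measurable_stacked_objective.
  by apply/seteqP; split => p /=; rewrite in_itv.
have sE v th : Theta th -> stacked_objective q (v, th) =
    n%:R^-1 * \sum_(i < n) (phi (G th (unstack i v) + q) - q).
  by move=> Tth; rewrite /stacked_objective /patch /= mem_set.
have := measurable_projection _ _ stack E K measurable_stack mE cK.
have -> : [set w | exists2 y, K y & E (stack w, y)] =
    [set w | exists2 th, K th & objective n (Z ^~ w) (th, q) <= r].
  apply/seteqP; split => w [th Kth]; rewrite /E /= => H; exists th => //.
    move: H; rewrite sE; last exact: KT.
    by under eq_bigr do rewrite unstackK.
  rewrite sE; last exact: KT.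
  by under eq_bigr do rewrite unstackK.
apply=> v.
(* The vector is read as an infinite sample; the value 0 from index [n] on never enters the
   objective. *)
pose u (i : nat) : 'rV[R]_d := if insub i is Some i' then unstack i' v else 0.
have -> : [set y | K y /\ E (v, y)] = [set y | K y /\ objective n u (y, q) <= r].
  apply/seteqP; split => th [Kth]; rewrite /E /= => H; split => //.
    move: H; rewrite sE; last exact: KT.
    rewrite /objective (eq_bigr (fun i : 'I_n => phi (G th (u i) + q) - q)) //.
    by move=> i _; rewrite /u valK.
  rewrite sE; last exact: KT.
  rewrite (eq_bigr (fun i : 'I_n => phi (G th (u i) + q) - q)) //.
  by move=> i _; rewrite /u valK.
apply: (lsc_on_closed_sublevel Theta) => //.
apply: (@lsc_on_subset _ _ ((fun th : 'rV[R]_m => (th, q)) @^-1` (Theta `*` setT))).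
  by move=> th.
apply: (lsc_on_comp _ (fun th : 'rV[R]_m => (th, q)) (objective n u));
  last exact: lsc_on_objective.
move=> th; apply: (@cvg_pair _ _ _ (nbhs th) (nbhs th) (nbhs q) _ _ _ id (fun=> q)).
  exact: cvg_id.
exact: cvg_cst.
Qed.

Lemma normal_integrand_objective :
  normal_integrand (Theta `*` setT) (fun w => objective n (Z ^~ w)).
Proof.
split=> [w|U [_ [V [oV ->]]]]; first by apply/lsc_onP; exact: lsc_on_objective.
(* The last condition does not involve [th], so [K q r k] is either a closed part of [Theta] or
   empty, and compact in both cases. *)
pose K (q r : rat) k : set 'rV[R]_m :=
  [set th | [/\ Theta th, closure (rat_ball k) th &
     forall y : 'rV[R]_m, closure (rat_ball k) y -> V ((y, ratr q), ratr r)]].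
have cK q r k : compact (K q r k).
  have [sub|nsub] := pselect (forall y : 'rV[R]_m,
      closure (rat_ball k) y -> V ((y, ratr q), ratr r)).
    rewrite (_ : K q r k = Theta `&` closure (rat_ball k)).
      by apply: compact_closedI => //; exact: closed_closure.
    by apply/seteqP; split => th; [case|case].
  rewrite (_ : K q r k = set0); first exact: compact0.
  by apply/seteqP; split => th // [].
have -> : [set w | epi_on (Theta `*` setT) (objective n (Z ^~ w)) `&`
      (V `&` (Theta `*` setT) `*` setT) !=set0] =
    \bigcup_(k in setT) \bigcup_(q in setT) \bigcup_(r in setT)
      [set w | exists2 th, K q r k th & objective n (Z ^~ w) (th, ratr q) <= ratr r].
  apply/seteqP; split => [w|w [k _ [q _ [r _ [th [Tth kth kV] le_r]]]]]; last first.
    by exists ((th, ratr q), ratr r); split => //; split; [exact: kV|split].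
  move=> [[[th x] t] [[/= [Tth _] fxt] [Vp _]]].
  have /nbhs_ballP[e /= e0 eV] : nbhs ((th, x), t) V by exact: open_nbhs_nbhs.
  have e2 : 0 < e / 2 by rewrite divr_gt0.
  (* Replacing [x] by [q] raises the objective by at most [x - q], so [r] is taken above
     [t + (x - q)] and still within [e] of [t]. *)
  have [q] := @rat_in_itvoo R (x - e / 2) x ltac:(by rewrite gtrBl).
  rewrite in_itv/= => /andP[xq qx].
  have [r] := @rat_in_itvoo R (t + (x - ratr q)) (t + e) ltac:(lra).
  rewrite in_itv/= => /andP[tr rt].
  have nth : nbhs th [set y : 'rV[R]_m | V ((y, ratr q), ratr r)].
    apply/nbhs_ballP; exists e => //= y thy; apply: eV; split; first split => //=.
      by rewrite /ball /= ger0_norm; lra.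
    by rewrite /ball /= ler0_norm; lra.
  have [k kth kV] := regular_base_rat_ball.2 _ _ nth.
  exists k => //; exists q => //; exists r => //; exists th.
    by split => //; exact: subset_closure.
  apply: le_trans (objective_shift n _ th x (ratr q) n_gt0 (ltW qx)) _.
  by apply: le_trans (ltW tr); rewrite lerD2r.
apply: bigcup_measurable => k _.
apply: bigcupT_measurable_rat => q; apply: bigcupT_measurable_rat => r.
by apply: measurable_slice => // th [].
Qed.

End measurability.
End empirical_objective.

(** Composition with the measurable [xi] transfers independence and equality of law to real
    variables, to which the one-sided strong law applies. *)
Lemma iid_average_eventually_le {R : realType} {dO} {Omega : measurableType dO}
    (P : probability Omega R) {d : nat} (Z : nat -> Omega -> 'rV[R]_d)
    (xi : 'rV[R]_d -> R) :
  (forall i, measurable_fun [set: Omega] (Z i : Omega -> Borel R d)) ->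
  mutually_independent P (Z : nat -> Omega -> Borel R d) ->
  identically_distributed P (Z : nat -> Omega -> Borel R d) ->
  (forall z, 0 <= xi z) ->
  (pushforward P (Z 0 : Omega -> Borel R d)).-integrable [set: Borel R d]
    (fun z => (xi z)%:E) ->
  exists A : set Omega, measurable A /\ P A = 1%E /\
    forall w, A w -> exists N, forall n, (N <= n)%N -> (0 < n)%N ->
      n%:R^-1 * \sum_(i < n) xi (Z i w) <= fine ('E_P[fun w => xi (Z 0%N w)])%E + 1.
Proof.
move=> mZ indep same xi0 intxi.
have mxi : measurable_fun [set: Borel R d] (xi : Borel R d -> R).
  by apply/measurable_EFinP; exact: measurable_int intxi.
pose X i w := xi (Z i w).
have mX i : measurable_fun setT (X i) by exact: (measurableT_comp mxi (mZ i)).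
have mpre (A : set R) : measurable A -> measurable ((xi @^-1` A) : set (Borel R d)).
  by move=> mA; rewrite -[X in measurable X]setTI; exact: mxi.
have indX i j : i <> j -> forall A B, measurable A -> measurable B ->
    P (X i @^-1` A `&` X j @^-1` B) = (P (X i @^-1` A) * P (X j @^-1` B))%E.
  move=> ij A B mA mB.
  (* Mutual independence is applied to the list [[:: i; j]], which is duplicate-free because
     [i <> j]. *)
  pose C k : set (Borel R d) := if k == i then xi @^-1` A else xi @^-1` B.
  have := indep [:: i; j] C; rewrite /= !inE andbT.
  move=> /(_ (introN eqP ij)).
  rewrite !big_cons !big_nil setIT mule1 /C eqxx.
  rewrite (_ : (j == i) = false); last by apply/eqP => ji; apply: ij.
  by apply=> k; case: ifP => _; exact: mpre.
have sameX i A : measurable A -> P (X i @^-1` A) = P (X 0%N @^-1` A).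
  by move=> /mpre; exact: same.
have intX : P.-integrable setT (EFin \o X 0%N).
  apply/integrableP; split; first exact/measurable_EFinP.
  have /integrableP[_] := intxi.
  by rewrite ge0_integral_pushforward//; apply: measurableT_comp => //;
    exact/measurable_EFinP.
have [A [mA [PA HA]]] := average_eventually_le P X mX (fun i w => xi0 _) indX sameX intX.
exists A; split => //; split => // w /HA[N HN]; exists N => n /HN Hn n0.
have -> : ('E_P[fun w => xi (Z 0%N w)] = \int[P]_w (xi (Z 0%N w))%:E)%E by rewrite unlock.
by rewrite ler_pdivrMl ?ltr0n.
Qed.

(** * Existence, localization and the almost sure statement *)

Theorem theorem7p2 (R : realType) (dO : measure_display)
  (Omega : measurableType dO) (P : probability Omega R)
  (m d : nat) (Theta : set 'rV[R]_m)
  (Z : nat -> Omega -> 'rV[R]_d) (G : 'rV[R]_m -> 'rV[R]_d -> R)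
  (Phi : R -> \bar R) (xi1 xi2 : 'rV[R]_d -> R) (x0 : R) :
  (* Theta nonempty compact subset of R^m *)
  Theta !=set0 -> compact Theta ->
  (* Z_1, Z_2, ... (here Z 0, Z 1, ...) i.i.d. R^d-valued random vectors *)
  (forall i, measurable_fun [set: Omega] (Z i : Omega -> Borel R d)) ->
  mutually_independent P (Z : nat -> Omega -> Borel R d) ->
  identically_distributed P (Z : nat -> Omega -> Borel R d) ->
  (* Phi : [0,oo[ -> [0,+oo] lsc, convex, Phi(0) < oo, inf Phi = 0,
     Phi(x)/x -> oo *)
  (forall x : R, 0 <= x -> (0 <= Phi x)%E) ->
  lsc_on_nonneg Phi -> convex_on_nonneg Phi ->
  (Phi 0%R < +oo)%E ->
  ereal_inf [set Phi x | x in [set x : R | 0 <= x]] = 0%E ->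
  (fun x : R => (Phi x * (x^-1)%:E)%E) x @[x --> +oo] --> +oo%E ->
  (* x0 > 1 with Phi(x0) < oo *)
  1 < x0 -> (Phi x0 < +oo)%E ->
  (* (A1) *)
  measurable_fun (Theta `*` setT : set (Borel R m * Borel R d))
    (fun p => G p.1 p.2) ->
  (forall z, @lower_semicontinuous (subspace Theta) R (fun th => (G th z)%:E)) ->
  (* (A2) *)
  (pushforward P (Z 0 : Omega -> Borel R d)).-integrable [set: Borel R d]
    (fun z => (xi1 z)%:E) ->
  (forall th z, Theta th -> `|G th z| <= xi1 z) ->
  (* (A3) *)
  (forall th, Theta th -> forall c : R, 0 < c ->
     (\int[P]_w conj_fun Phi (c * `|G th (Z 0%N w)|) < +oo)%E) ->
  (pushforward P (Z 0 : Omega -> Borel R d)).-integrable [set: Borel R d]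
    (fun z => (xi2 z)%:E) ->
  (forall th z, Theta th -> (`|conj_fun Phi (G th z)| <= (xi2 z)%:E)%E) ->
  let E1 := fine ('E_P[fun w => xi1 (Z 0%N w)])%E in
  let E2 := fine ('E_P[fun w => xi2 (Z 0%N w)])%E in
  let xl := - fine (Phi 0) - 1 - E2 in
  let xu := (fine (Phi x0) + 1 + x0 + E2 + x0 * E1) / (x0 - 1) in
  let A_ (n : nat) := [set w : Omega |
    Num.max `|n%:R^-1 * \sum_(i < n) xi1 (Z i w) - E1|
            `|n%:R^-1 * \sum_(i < n) xi2 (Z i w) - E2| <= 1] in
  (forall n, (0 < n)%N -> normal_integrand (Theta `*` setT) (Xn Phi G Z n)) /\
  (forall n w, (0 < n)%N -> Sn Phi Theta G Z n w !=set0) /\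
  (forall n w, (0 < n)%N -> A_ n w ->
     Sn Phi Theta G Z n w `<=` Theta `*` [set x | xl <= x <= xu]) /\
  (exists A : set Omega, measurable A /\ P A = 1%E /\
     forall w, A w -> exists nw : nat, (0 < nw)%N /\
       forall n, (nw <= n)%N ->
         Sn Phi Theta G Z n w `<=` Theta `*` [set x | xl <= x <= xu]).
Proof.
move=> Theta0 cTheta mZ indep same Phi_ge0 _ _ Phi0 _ growth x01 Phix0 mG lscG
  int1 xi1P _ int2 xi2P E1 E2 xl xu A_.
(* A point of [Theta] shows that [xi1] and [xi2] dominate absolute values, hence are nonnegative, as
   the one-sided strong law requires. *)
have [th0 Tth0] := Theta0.
have xi1_ge0 z : 0 <= xi1 z by exact: le_trans (normr_ge0 _) (xi1P th0 z Tth0).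
have xi2_ge0 z : 0 <= xi2 z.
  by rewrite -lee_fin; exact: le_trans (abse_ge0 _) (xi2P th0 z Tth0).
have lscG' z : lsc_on Theta (G ^~ z) by apply/lsc_onP; exact: lscG.
have SnP n w p : Sn Phi Theta G Z n w p <-> (Theta `*` setT) p /\
    forall q, (Theta `*` setT) q -> Xn Phi G Z n w p <= Xn Phi G Z n w q.
  split=> -[Tp Hp]; split => //.
    move=> q Tq; rewrite -lee_fin Hp; apply: ereal_inf_lbound.
    by exists q.
  apply/eqP; rewrite eq_le; apply/andP; split.
    by apply: le_ereal_inf_tmp => _ [q Tq <-]; rewrite lee_fin; exact: Hp.
  by apply: ereal_inf_lbound; exists p.
(* Common core of both localization claims: comparison with the point [(th, 0)] places a minimizer
   in the sublevel set of [objective_sublevel]. *)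
have box n w : (0 < n)%N -> n%:R^-1 * \sum_(i < n) xi1 (Z i w) <= E1 + 1 ->
    n%:R^-1 * \sum_(i < n) xi2 (Z i w) <= E2 + 1 ->
    Sn Phi Theta G Z n w `<=` Theta `*` [set x | xl <= x <= xu].
  move=> n0 a1 a2 [th x] /SnP[[/= Tth _] Hmin]; split => //=.
  have := objective_sublevel Theta G Phi xi1 xi2 x0 Phi_ge0 Phi0 growth x01 Phix0
    xi1P n (Z ^~ w) th x n0 Tth.
  have at0 := objective_at0_le Theta G Phi xi2 Phi_ge0 Phi0 growth xi2P n (Z ^~ w) th n0 Tth.
  move=> /(_ (le_trans (Hmin (th, 0) (conj Tth I)) at0)) /andP[lx xu'].
  apply/andP; split; first by apply: le_trans lx; rewrite /xl; lra.
  apply: (le_trans xu'); rewrite /xu ler_pM2r ?invr_gt0 ?subr_gt0//.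
  have : x0 * (n%:R^-1 * \sum_(i < n) xi1 (Z i w)) <= x0 * (E1 + 1).
    by rewrite ler_pM2l// (lt_trans ltr01).
  by rewrite mulrDr mulr1; lra.
split.
  move=> n n0.
  exact: (normal_integrand_objective Theta G Phi cTheta Phi_ge0 Phi0 growth lscG' Z n n0 mZ mG).
split.
  move=> n w n0.
  have [p Tp pmin] := objective_argmin Theta G Phi xi1 xi2 x0 Theta0 cTheta Phi_ge0
    Phi0 growth x01 Phix0 lscG' xi1P xi2P n (Z ^~ w) n0.
  by exists p; apply/SnP; split.
split.
  move=> n w n0; rewrite /A_ /= ge_max => /andP[].
  rewrite !ler_distl => /andP[_ a1] /andP[_ a2].
  exact: box.
have [A1 [mA1 [PA1 HA1]]] := iid_average_eventually_le P Z xi1 mZ indep same xi1_ge0 int1.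
have [A2 [mA2 [PA2 HA2]]] := iid_average_eventually_le P Z xi2 mZ indep same xi2_ge0 int2.
exists (A1 `&` A2); split; first exact: measurableI.
split.
  have PC B : measurable B -> P B = 1%E -> P (~` B) = 0%E.
    by move=> mB PB; rewrite probability_setC// PB subee.
  rewrite -[A1 `&` A2]setCK setCI probability_setC; last first.
    by apply: measurableU; exact: measurableC.
  suff -> : P (~` A1 `|` ~` A2) = 0%E by rewrite sube0.
  apply/eqP; rewrite eq_le measure_ge0 andbT.
  apply: (le_trans (measureU2 _ (measurableC mA1) (measurableC mA2))).
  rewrite -[leRHS](adde0 0%E); apply: leeD.
    by rewrite -(PC A1 mA1 PA1).
  by rewrite -(PC A2 mA2 PA2).
(* The successor makes the threshold, and with it every later [n], positive. *)
move=> w [/HA1[N1 H1] /HA2[N2 H2]]; exists (maxn N1 N2).+1; split => // n nN.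
have n0 : (0 < n)%N by exact: leq_trans nN.
apply: box => //.
  by apply: H1 => //; apply: leq_trans (ltnW nN); rewrite leq_maxl.
by apply: H2 => //; apply: leq_trans (ltnW nN); rewrite leq_maxr.
Qed.
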